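(* Let $n\geq 6$ and $p\geq 2$. Among all bicyclic graphs of order $n$, $B_1$, $B_2$ and $B_3$ are, respectively, the unique bicyclic graphs with the first three maximum $p$-Sombor spectral radii; that is, for every bicyclic graph $G$ of order $n$ not isomorphic to $B_1,B_2,B_3$, $$\rho(\mathbf{S}_{p}(G))<\rho(\mathbf{S}_{p}(B_3))<\rho(\mathbf{S}_{p}(B_2))<\rho(\mathbf{S}_{p}(B_1)).$$
   Context: All graphs are simple and connected; $d_i$ is the degree of $v_i$. The $p$-Sombor matrix $\mathbf{S}_{p}(G)$ has $(i,j)$-entry $(d_i^{p}+d_j^{p})^{1/p}$ if $v_iv_j\in E(G)$ and $0$ otherwise; $\rho(\mathbf{S}_{p}(G))$ is its largest eigenvalue. A bicyclic graph is a connected graph with $|E|=|V|+1$. The diamond is $K_4$ minus an edge, with adjacent degree-3 vertices $u,v$. The graphs (all of order $n$): $B_1$ is the diamond with $n-4$ pendant vertices attached to $u$; $B_2$ consists of two triangles sharing exactly one vertex $c$, with $n-5$ pendant vertices attached to $c$; $B_3$ is the diamond with $n-5$ pendant vertices attached to $u$ and one pendant vertex attached to $v$. *)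

(* Defs.v *)
From HB Require Import structures.
From mathcomp Require Import all_boot all_order all_algebra.
From mathcomp Require Import classical_sets reals exp.
Set Implicit Arguments. Unset Strict Implicit. Unset Printing Implicit Defensive.
Import Order.TTheory GRing.Theory Num.Theory.
Local Open Scope ring_scope.

Definition simple_graph n (e : rel 'I_n) : Prop :=
  irreflexive e /\ symmetric e.

Definition connected_graph n (e : rel 'I_n) : Prop :=
  forall x y : 'I_n, connect e x y.

Definition nedges n (e : rel 'I_n) : nat :=
  #|[set xy : 'I_n * 'I_n | e xy.1 xy.2 && (xy.1 < xy.2)%N]|.

Definition bicyclic n (e : rel 'I_n) : Prop :=
  [/\ simple_graph e, connected_graph e & nedges e = n.+1].

Definition deg n (e : rel 'I_n) (x : 'I_n) : nat := #|[set y | e x y]|.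

Definition graph_iso n (e1 e2 : rel 'I_n) : Prop :=
  exists f : 'I_n -> 'I_n, bijective f /\ forall x y, e1 x y = e2 (f x) (f y).

Definition psombor_mx (R : realType) n (p : R) (e : rel 'I_n) : 'M[R]_n :=
  \matrix_(i, j) (if e i j
                  then ((deg e i)%:R `^ p + (deg e j)%:R `^ p) `^ (p^-1)
                  else 0).

(* largest eigenvalue (the spectrum of a real symmetric matrix is a
   finite nonempty set of reals, so its supremum is its maximum) *)
Definition rho (R : realType) n (A : 'M[R]_n) : R :=
  sup [set a : R | eigenvalue A a].

Definition sym_of n (adj : nat -> nat -> bool) : rel 'I_n :=
  fun x y => if (x < y)%N then adj x y else if (y < x)%N then adj y x else false.

(* Vertex labels: diamond on 0,1,2,3 with u = 0, v = 1 (degree-3 vertices),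
   2 and 3 the degree-2 vertices. *)
Definition B1adj (i j : nat) : bool :=
  ((i == 0%N) && (1 <= j)%N) || ((i == 1%N) && ((j == 2%N) || (j == 3%N))).
(* two triangles 0-1-2 and 0-3-4 sharing c = 0; pendants 5..n-1 at 0 *)
Definition B2adj (i j : nat) : bool :=
  ((i == 0%N) && (1 <= j)%N) || ((i == 1%N) && (j == 2%N)) || ((i == 3%N) && (j == 4%N)).
(* diamond as in B1, pendant 4 at v = 1, pendants 5..n-1 at u = 0 *)
Definition B3adj (i j : nat) : bool :=
  ((i == 0%N) && (1 <= j)%N && (j != 4%N))
  || ((i == 1%N) && [|| j == 2%N, j == 3%N | j == 4%N]).

Definition B1 n : rel 'I_n := @sym_of n B1adj.
Definition B2 n : rel 'I_n := @sym_of n B2adj.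
Definition B3 n : rel 'I_n := @sym_of n B3adj.
Arguments B1 n : clear implicits.
Arguments B2 n : clear implicits.
Arguments B3 n : clear implicits.

(* Main.v *)
(** Moving neighbours of [v] to [u] (a Kelmans shift) never lowers the quadratic
    form at a Perron vector [x] with [x v <= x u]: the edges of [u] gain more than
    those of [v] lose because [d |-> (d^p + j^p)^(1/p)] is increasing and convex.
    Apart from B1 and B2, bicyclic graphs have no universal vertex. A graph of
    maximal radius among those without universal vertex admits no strictly
    improving shift that keeps this property; such a graph is B3 or a "kite"
    (u ~ b, b', pendants; b ~ b'; w ~ b, b'), and the Perron vector of the kite,
    with two entries exchanged, shows that B3 does better than the kite.
    Shifting B2 produces B1. B3 and B2 are separated by an explicit number [c]:
    a positive vector [y] with [A y <= c y] for B3 and a test vector for B2; this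
    is crude for n >= 7 and needs the exact dependence on p for n = 6. *)
Require Import Defs.
From HB Require Import structures.
From mathcomp Require Import all_boot all_order all_algebra.
From mathcomp Require Import classical_sets reals exp.
From mathcomp Require Import sequences boolp ring lra zify.
Set Implicit Arguments. Unset Strict Implicit. Unset Printing Implicit Defensive.
Import Order.TTheory GRing.Theory Num.Theory.
Local Open Scope ring_scope.

(** * Rayleigh quotients and Perron vectors *)

(** Universal vertices have to be excluded because shifts otherwise lead on to B1 or B2, and the
    third place stays invisible. The price is that a shift must leave some vertex outside the
    neighbourhood of its target. Where the full shift would swallow every vertex, only part of it is
    performed. No sequence of shifts is followed: there are finitely many graphs on ['I_n], so a
    maximum exists, and the local conditions at it are confronted with an edge count. For [p >= 2] a
    weight lies between the larger degree and the Euclidean norm of the two degrees. For large order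
    this range is narrow enough to bound B3 from above and B2 from below without reference to [p].
    On six vertices the resulting ranges of the two radii overlap, so both graphs have to be
    compared at the same [p]. The spectral facts rest on one inequality for positive semidefinite
    forms, [psd_sqn_le]: it shows that the supremum of the Rayleigh quotient is an eigenvalue and
    that vectors attaining it are eigenvectors. *)

Definition bform (R : realType) n (A : 'M[R]_n) (x y : 'rV[R]_n) : R :=
  (x *m A *m y^T) 0 0.

Definition sqn (R : realType) n (x : 'rV[R]_n) : R := \sum_i x 0 i ^+ 2.

Lemma bformE (R : realType) n (A : 'M[R]_n) x y :
  bform A x y = \sum_j (\sum_i x 0 i * A i j) * y 0 j.
Proof.
by rewrite /bform mxE; apply: eq_bigr => j _; rewrite !mxE.
Qed.

Lemma sqnE (R : realType) n (x : 'rV[R]_n) : sqn x = (x *m x^T) 0 0.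
Proof. by rewrite mxE; apply: eq_bigr => j _; rewrite !mxE. Qed.

Lemma sqn_ge0 (R : realType) n (x : 'rV[R]_n) : 0 <= sqn x.
Proof. by apply: sumr_ge0 => i _; rewrite sqr_ge0. Qed.

Lemma sqn_gt0 (R : realType) n (x : 'rV[R]_n) : (0 < sqn x) = (x != 0).
Proof.
rewrite lt0r sqn_ge0 andbT; congr (~~ _).
rewrite psumr_eq0 => [|i _]; last by rewrite sqr_ge0.
apply/allP/eqP => [h|-> i _]; last by rewrite mxE expr0n eqxx.
apply/rowP => i; rewrite mxE; apply/eqP.
rewrite -sqrf_eq0; exact: (h i (mem_index_enum i)).
Qed.

Lemma bform_line (R : realType) n (A : 'M[R]_n) (x y : 'rV[R]_n) (s : R) :
  A^T = A ->
  bform A (x + s *: y) (x + s *: y) =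
  bform A x x + 2 * s * bform A x y + s ^+ 2 * bform A y y.
Proof.
move=> sA.
have sym : bform A y x = bform A x y.
  by rewrite /bform -[in LHS](trmxK (y *m A *m x^T)) [LHS]mxE !trmx_mul trmxK sA mulmxA.
have bD u v w : bform A (u + s *: v) w = bform A u w + s * bform A v w.
  by rewrite /bform !mulmxDl -!scalemxAl [LHS]mxE [X in _ + X = _]mxE.
have bDr u v w : bform A w (u + s *: v) = bform A w u + s * bform A w v.
  by rewrite /bform linearD linearZ /= mulmxDr -!scalemxAr [LHS]mxE [X in _ + X = _]mxE.
by rewrite bD !bDr sym; ring.
Qed.

Lemma bform_bound (R : realType) n (A : 'M[R]_n) :
  exists2 K, 0 < K & forall x : 'rV_n, bform A x x <= K * sqn x.
Proof.
exists (1 + \sum_j \sum_i `|A i j|).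
  by rewrite ltr_pwDl ?ltr01 // !sumr_ge0 // => j _; apply: sumr_ge0.
move=> x; rewrite mulrDl mul1r.
suff h : bform A x x <= (\sum_j \sum_i `|A i j|) * sqn x.
  by rewrite (le_trans h) // lerDr sqn_ge0.
rewrite bformE mulr_suml; apply: ler_sum => j _.
rewrite !mulr_suml; apply: ler_sum => i _.
have le1 k : x 0 k ^+ 2 <= sqn x.
  by rewrite /sqn (bigD1 k) //= lerDl sumr_ge0 // => l _; rewrite sqr_ge0.
have le2 : `|x 0 i * x 0 j| <= sqn x.
  rewrite normrM; have := le1 i; have := le1 j.
  have nK k : x 0 k ^+ 2 = `|x 0 k| ^+ 2 by rewrite real_normK ?num_real.
  by rewrite !nK => hj hi; have := sqr_ge0 (`|x 0 i| - `|x 0 j|); nra.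
apply: le_trans (ler_norm _) _.
rewrite mulrAC normrM mulrC; exact: ler_wpM2l.
Qed.

(** The form stays nonnegative on the line through [x] in direction [x *m B]; at parameter [- K^-1]
    the quadratic term uses up at most half of the linear one. In particular [x *m B = 0] wherever
    the form vanishes. *)
Lemma psd_sqn_le (R : realType) n (B : 'M[R]_n) : B^T = B ->
  (forall x, 0 <= bform B x x) ->
  exists2 K, 0 < K & forall x, sqn (x *m B) <= K * bform B x x.
Proof.
move=> sB psd; have [K K0 hK] := bform_bound B; exists K => // x.
have := psd (x + (- K^-1) *: (x *m B)); rewrite bform_line //.
have -> : bform B x (x *m B) = sqn (x *m B) by rewrite sqnE.
have := hK (x *m B); set a := bform B x x; set b := bform B _ _; set N := sqn _.
move=> hb h.
have h2 : (- K^-1) ^+ 2 * b <= K^-1 * N.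
  rewrite sqrrN expr2 -mulrA ler_pM2l ?invr_gt0 // mulrC ler_pdivrMr //.
  by rewrite mulrC.
have h3 : K^-1 * N <= a by nra.
by rewrite -ler_pdivrMl // .
Qed.

(* If [mu I - A] were invertible, [psd_sqn_le] would keep the Rayleigh quotient
   uniformly below the supremum [mu]. *)
Lemma max_rayleigh (R : realType) n (A : 'M[R]_n) : A^T = A -> (0 < n)%N ->
  exists mu, eigenvalue A mu /\ forall x, bform A x x <= mu * sqn x.
Proof.
move=> sA n0.
pose E := [set r : R | exists2 x, x != 0 & r = bform A x x / sqn x]%classic.
have [K K0 hK] := bform_bound A.
have ubE : ubound E K.
  by move=> _ [x x0 ->]; rewrite ler_pdivrMr ?sqn_gt0.
have supE : has_sup E.
  split; last by exists K.
  exists (bform A (const_mx 1) (const_mx 1) / sqn (const_mx 1 : 'rV[R]_n)).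
  exists (const_mx 1) => //.
  apply/eqP => /rowP /(_ (Ordinal n0)); rewrite !mxE => /eqP.
  by rewrite oner_eq0.
pose mu := sup E.
have hmu x : bform A x x <= mu * sqn x.
  have [->|x0] := eqVneq x 0.
    by rewrite /bform !mul0mx mxE /sqn big1 ?mulr0 // => i _; rewrite mxE expr0n.
  rewrite -ler_pdivrMr ?sqn_gt0 //; apply: ub_le_sup; last by exists x.
  by case: supE.
exists mu; split => //.
pose B := mu%:M - A.
have sB : B^T = B by rewrite linearB /= tr_scalar_mx sA.
have BE x : bform B x x = mu * sqn x - bform A x x.
  rewrite /bform mulmxBr mulmxBl mul_mx_scalar -scalemxAl sqnE.
  by rewrite !mxE.
have psd x : 0 <= bform B x x by rewrite BE subr_ge0.
have [K1 K10 hK1] := psd_sqn_le sB psd.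
apply/eigenvalueP; have [BU|] := boolP (B \in unitmx); last first.
  rewrite unitmxE unitfE negbK => /det0P [v v0 vB]; exists v => //.
  move: vB; rewrite mulmxBr mul_mx_scalar => /eqP; rewrite subr_eq0.
  by move=> /eqP.
have [K2 K20 hK2] := bform_bound (invmx B *m (invmx B)^T).
have lo x : sqn x <= K2 * K1 * bform B x x.
  have <- : x *m B *m invmx B = x by rewrite mulmxK.
  have -> : sqn (x *m B *m invmx B)
            = bform (invmx B *m (invmx B)^T) (x *m B) (x *m B).
    by rewrite sqnE /bform !trmx_mul !mulmxA.
  apply: le_trans (hK2 _) _; rewrite -mulrA ler_pM2l //.
  by rewrite (mulmxK BU); exact: hK1.
have K30 : 0 < K2 * K1 by rewrite mulr_gt0.
have ub2 : ubound E (mu - (K2 * K1)^-1).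
  move=> _ [x x0 ->]; rewrite ler_pdivrMr ?sqn_gt0 // mulrBl.
  have := lo x; rewrite BE -ler_pdivrMl //; lra.
have := ge_sup (proj1 supE) ub2; rewrite -/mu => h.
by have : 0 < (K2 * K1)^-1; [rewrite invr_gt0 | lra].
Qed.

Lemma rho_eigen (R : realType) n (A : 'M[R]_n) : A^T = A -> (0 < n)%N ->
  eigenvalue A (rho A) /\ forall x, bform A x x <= rho A * sqn x.
Proof.
move=> sA n0; have [mu [emu hmu]] := max_rayleigh sA n0.
suff -> : rho A = mu by [].
have ub : ubound [set a : R | eigenvalue A a]%classic mu.
  move=> a /eigenvalueP [v vA v0].
  have := hmu v; rewrite /bform vA -scalemxAl mxE -sqnE.
  by rewrite ler_pM2r ?sqn_gt0.
apply/eqP; rewrite eq_le; apply/andP; split.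
  by apply: ge_sup => //; exists mu.
by apply: ub_le_sup => //; exists mu.
Qed.

(** Absolute values do not lower the form of a nonnegative matrix, so those of a top eigenvector
    attain the maximum again. There the semidefinite form of [rho A - A] vanishes, and [psd_sqn_le]
    turns this into the eigenvector equation. *)
Lemma rho_perron (R : realType) n (A : 'M[R]_n) : A^T = A -> (0 < n)%N ->
  (forall i j, 0 <= A i j) ->
  exists x : 'rV[R]_n, [/\ x != 0, forall i, 0 <= x 0 i & x *m A = rho A *: x].
Proof.
move=> sA n0 A0; have [/eigenvalueP [v vA v0] hmu] := rho_eigen sA n0.
pose x : 'rV[R]_n := \row_i `|v 0 i|.
have sx : sqn x = sqn v.
  by apply: eq_bigr => i _; rewrite mxE real_normK ?num_real.
have x0 : x != 0 by rewrite -sqn_gt0 sx sqn_gt0.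
exists x; split => //; first by move=> i; rewrite mxE.
have hv : bform A v v = rho A * sqn v by rewrite /bform vA -scalemxAl mxE -sqnE.
have hx : bform A v v <= bform A x x.
  rewrite !bformE; apply: ler_sum => j _; rewrite !mulr_suml.
  apply: ler_sum => i _; rewrite !mxE; apply: le_trans (ler_norm _) _.
  by rewrite !normrM (ger0_norm (A0 i j)).
pose B := (rho A)%:M - A.
have sB : B^T = B by rewrite linearB /= tr_scalar_mx sA.
have BE y : bform B y y = rho A * sqn y - bform A y y.
  rewrite /bform mulmxBr mulmxBl mul_mx_scalar -scalemxAl sqnE.
  by rewrite !mxE.
have psd y : 0 <= bform B y y by rewrite BE subr_ge0.
have [K1 K10 hK1] := psd_sqn_le sB psd.
have Bx0 : bform B x x <= 0 by rewrite BE sx -hv subr_le0.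
have : ~~ (0 < sqn (x *m B)).
  rewrite -leNgt; apply: le_trans (hK1 x) _.
  by rewrite pmulr_rle0.
rewrite sqn_gt0 negbK mulmxBr mul_mx_scalar subr_eq0 => /eqP <- //.
Qed.

(** A Collatz-Wielandt bound: the row inequalities are paired with a nonnegative eigenvector for
    [rho A], whose pairing with [y] is positive and cancels. *)
Lemma rho_le_super (R : realType) n (A : 'M[R]_n) (y : 'I_n -> R) (c : R) :
  A^T = A -> (0 < n)%N -> (forall i j, 0 <= A i j) -> (forall i, 0 < y i) ->
  (forall i, \sum_j A i j * y j <= c * y i) -> rho A <= c.
Proof.
move=> sA n0 A0 y0 hy; have [x [x0 xge xA]] := rho_perron sA n0 A0.
have xy : 0 < \sum_i x 0 i * y i.
  have [i xi] : exists i, x 0 i != 0.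
    apply/existsP; apply: contraNT x0; rewrite negb_exists => /forallP h.
    by apply/eqP/rowP => i; rewrite mxE; apply/eqP; have := h i; rewrite negbK.
  rewrite (bigD1 i) //= ltr_pwDl //.
    by rewrite mulr_gt0 // lt0r xi xge.
  by apply: sumr_ge0 => j _; rewrite mulr_ge0 // ltW.
rewrite -(ler_pM2r xy).
have -> : rho A * (\sum_i x 0 i * y i) = \sum_j (x *m A) 0 j * y j.
  by rewrite xA mulr_sumr; apply: eq_bigr => i _; rewrite mxE mulrA.
under eq_bigr do rewrite mxE mulr_suml.
rewrite exchange_big mulr_sumr; apply: ler_sum => i _.
have -> : \sum_j x 0 i * A i j * y j = x 0 i * \sum_j A i j * y j.
  by rewrite mulr_sumr; apply: eq_bigr => j _; rewrite mulrA.
by rewrite [leRHS]mulrCA ler_wpM2l.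
Qed.

Lemma rho_rayleigh (R : realType) n (A : 'M[R]_n) (y : 'I_n -> R) :
  A^T = A -> (0 < n)%N ->
  \sum_i \sum_j A i j * y i * y j <= rho A * \sum_i y i ^+ 2.
Proof.
move=> sA n0; have [_ /(_ (\row_i y i))] := rho_eigen sA n0.
rewrite bformE /sqn.
under [in X in _ <= X -> _]eq_bigr do rewrite mxE.
move=> /(le_trans _); apply; rewrite le_eqVlt; apply/orP; left; apply/eqP.
rewrite exchange_big; apply: eq_bigr => j _; rewrite mxE mulr_suml.
by apply: eq_bigr => i _; rewrite mxE; ring.
Qed.

(** * The l^p norm of a pair *)

(* Convexity of [expR]: its tangent at [t * s] lies below it at [s] and at [0]. *)
Lemma bernoulli_le1 (R : realType) (y t : R) : 0 < y -> 0 <= t <= 1 ->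
  y `^ t <= 1 + t * (y - 1).
Proof.
move=> y0 /andP[t0 t1]; rewrite /powR gt_eqF //.
set s := ln y; have ys : y = expR s by rewrite lnK.
rewrite ys; set b := expR (t * s).
have b0 : 0 < b := expR_gt0 _.
have h1 : b * (1 + (1 - t) * s) <= expR s.
  have {2}-> : s = t * s + (1 - t) * s by ring.
  by rewrite expRD ler_wpM2l ?(ltW b0) // expR_ge1Dx.
have h2 : b * (1 - t * s) <= 1.
  rewrite -[leRHS](expR0) -(subrr (t * s)) expRD ler_wpM2l ?(ltW b0) //.
  exact: expR_ge1Dx.
have h3 : t * (b * (1 + (1 - t) * s)) <= t * expR s by rewrite ler_wpM2l.
have h4 : (1 - t) * (b * (1 - t * s)) <= (1 - t) * 1.
  by rewrite ler_wpM2l // subr_ge0.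
have -> : b = t * (b * (1 + (1 - t) * s)) + (1 - t) * (b * (1 - t * s)) by ring.
lra.
Qed.

Lemma bernoulli_ge1 (R : realType) (u p : R) : 0 <= u -> 1 <= p ->
  1 + p * (u - 1) <= u `^ p.
Proof.
move=> u0 p1; have p0 : 0 < p by lra.
move: u0; rewrite le_eqVlt => /predU1P[<-|u0].
  by rewrite powR0 ?gt_eqF //; lra.
have := @bernoulli_le1 R (u `^ p) p^-1 (powR_gt0 _ u0).
rewrite invr_ge0 (ltW p0) invf_le1 // p1 => /(_ isT).
rewrite -powRrM mulfV ?gt_eqF // powRr1 ?(ltW u0) // => h.
have := ler_wpM2l (ltW p0) h.
rewrite mulrDr mulrA mulfV ?gt_eqF //; lra.
Qed.

(** [bernoulli_ge1], scaled by the mean [m], is the tangent to the power at [m]; the two tangent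
    values average to the value at [m]. *)
Lemma powR_convex (R : realType) (p t x y : R) : 1 <= p -> 0 <= t <= 1 ->
  0 <= x -> 0 <= y ->
  (t * x + (1 - t) * y) `^ p <= t * x `^ p + (1 - t) * y `^ p.
Proof.
move=> p1 /andP[t0 t1] x0 y0; set m := t * x + _.
have p0 : 0 < p by lra.
have t'0 : 0 <= 1 - t by lra.
have : 0 <= m by rewrite addr_ge0 // mulr_ge0.
rewrite le_eqVlt => /predU1P[<-|m0].
  by rewrite powR0 ?gt_eqF // addr_ge0 // mulr_ge0 // powR_ge0.
have tg z : 0 <= z -> m `^ p * (1 + p * (z / m - 1)) <= z `^ p.
  move=> z0; have zm : 0 <= z / m by rewrite divr_ge0 // ltW.
  have {2}-> : z = m * (z / m) by rewrite mulrCA mulfV ?mulr1 ?gt_eqF.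
  by rewrite powRM ?(ltW m0) // ler_wpM2l ?powR_ge0 // bernoulli_ge1.
have -> : m `^ p = t * (m `^ p * (1 + p * (x / m - 1))) +
                   (1 - t) * (m `^ p * (1 + p * (y / m - 1))).
  have e : (t * x + (1 - t) * y) / m = 1 by rewrite divff ?gt_eqF.
  transitivity (m `^ p * (1 + p * ((t * x + (1 - t) * y) / m - 1))).
    by rewrite e subrr mulr0 addr0 mulr1.
  by ring.
by rewrite lerD // ler_wpM2l // tg.
Qed.

(** Both [d] and [c + k] lie on the segment from [c] to [d + k], with weights exchanged, so the two
    convexity inequalities add up to the claim. *)
Lemma convex_increments (R : realType) (f : R -> R) (c d k : R) :
  (forall t x y, 0 <= t <= 1 -> 0 <= x -> 0 <= y ->
     f (t * x + (1 - t) * y) <= t * f x + (1 - t) * f y) ->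
  0 <= c -> c <= d -> 0 <= k -> f d + f (c + k) <= f c + f (d + k).
Proof.
move=> cf c0 cd; rewrite le_eqVlt => /predU1P[<-|k0].
  by rewrite !addr0 addrC.
pose s := d + k - c; have s0 : 0 < s by rewrite /s; lra.
pose t := k / s.
have t01 : 0 <= t <= 1.
  rewrite divr_ge0 ?(ltW k0) ?(ltW s0) //= ler_pdivrMr // mul1r /s; lra.
have t'01 : 0 <= 1 - t <= 1 by lra.
have ts : t * s = k by rewrite mulfVK ?gt_eqF.
have dk0 : 0 <= d + k by lra.
have := cf _ _ _ t01 c0 dk0; have := cf _ _ _ t'01 c0 dk0.
have -> : t * c + (1 - t) * (d + k) = d.
  by transitivity (d + k - t * s); [rewrite /s; ring | rewrite ts; ring].
have -> : (1 - t) * c + (1 - (1 - t)) * (d + k) = c + k.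
  by transitivity (c + t * s); [rewrite /s; ring | rewrite ts].
lra.
Qed.

Definition pnorm (R : realType) (p x y : R) : R := (x `^ p + y `^ p) `^ p^-1.

Lemma pnormC (R : realType) (p x y : R) : pnorm p x y = pnorm p y x.
Proof. by rewrite /pnorm addrC. Qed.

Lemma pnorm_ge0 (R : realType) (p x y : R) : 0 <= pnorm p x y.
Proof. exact: powR_ge0. Qed.

Lemma pnorm_gt0 (R : realType) (p x y : R) : 0 < x -> 0 < pnorm p x y.
Proof. by move=> x0; rewrite powR_gt0 // ltr_pwDl ?powR_gt0 ?powR_ge0. Qed.

Lemma pnormK (R : realType) (p x y : R) : 0 < p ->
  pnorm p x y `^ p = x `^ p + y `^ p.
Proof.
by move=> p0; rewrite -powRrM mulVf ?gt_eqF // powRr1 // addr_ge0 // powR_ge0.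
Qed.

Lemma powR_le_iff (R : realType) (p a b : R) : 0 < p -> 0 <= a -> 0 <= b ->
  (a `^ p <= b `^ p) = (a <= b).
Proof.
move=> p0 a0 b0; apply/idP/idP.
  by apply: contraTT; rewrite -!ltNge => ?; exact: gt0_ltr_powR.
by move=> ?; apply: (ge0_ler_powR (ltW p0)); rewrite ?nnegrE.
Qed.

Lemma pnorm_le_iff (R : realType) (p x y z : R) : 0 < p -> 0 <= z ->
  (pnorm p x y <= z) = (x `^ p + y `^ p <= z `^ p).
Proof. by move=> p0 z0; rewrite -pnormK // powR_le_iff // pnorm_ge0. Qed.

Lemma pnorm_lt (R : realType) (p x x' y : R) : 0 < p -> 0 <= x -> x < x' ->
  pnorm p x y < pnorm p x' y.
Proof.
move=> p0 x0 xx'; rewrite ltNge pnorm_le_iff ?pnorm_ge0 // pnormK // -ltNge.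
rewrite ltrD2r; apply: gt0_ltr_powR; rewrite ?nnegrE //; lra.
Qed.

Lemma pnorm_le (R : realType) (p x x' y y' : R) : 0 < p ->
  0 <= x -> x <= x' -> 0 <= y -> y <= y' -> pnorm p x y <= pnorm p x' y'.
Proof.
move=> p0 x0 xx' y0 yy'; rewrite pnorm_le_iff ?pnorm_ge0 // pnormK //.
by rewrite lerD // powR_le_iff //; lra.
Qed.

Lemma pnorm_ge_max (R : realType) (p x y : R) : 0 < p -> 0 <= x ->
  x <= pnorm p x y.
Proof.
move=> p0 x0; rewrite -(powR_le_iff p0) ?pnorm_ge0 // pnormK //.
by rewrite lerDl powR_ge0.
Qed.

Lemma powR_half (R : realType) (p x : R) : 0 <= x -> (x ^+ 2) `^ (p / 2) = x `^ p.
Proof.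
move=> x0; rewrite -powR_mulrn // -powRrM; congr (_ `^ _).
by rewrite mulrC mulfVK // pnatr_eq0.
Qed.

(** Each squared coordinate is a fraction of the squared Euclidean norm [s]. Raising a fraction to
    the power [p / 2 >= 1] does not increase it, and the two fractions sum to 1. *)
Lemma pnorm_sqr_le (R : realType) (p x y : R) : 2 <= p -> 0 < x -> 0 <= y ->
  pnorm p x y ^+ 2 <= x ^+ 2 + y ^+ 2.
Proof.
move=> p2 x0 y0; have p0 : 0 < p by lra.
have h0 : 0 < p / 2 by lra.
set s := _ + _; have s0 : 0 < s by rewrite ltr_pwDl ?exprn_gt0 ?sqr_ge0.
rewrite -(powR_le_iff h0) ?sqr_ge0 ?(ltW s0) // powR_half ?pnorm_ge0 // pnormK //.
have tg z : 0 <= z -> z <= s -> z `^ (p / 2) <= z / s * s `^ (p / 2).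
  rewrite le_eqVlt => /predU1P[<- _|z0 zs].
    by rewrite powR0 ?gt_eqF // mul0r mul0r.
  have {1}-> : z = z / s * s by rewrite mulfVK ?gt_eqF.
  apply: ge1r_powRZ; [|lra|lra].
  by rewrite divr_gt0 //= ler_pdivrMr // mul1r.
rewrite -(powR_half p (ltW x0)) -(powR_half p y0).
apply: le_trans (lerD (tg _ _ _) (tg _ _ _)) _; rewrite ?sqr_ge0 //.
- by rewrite /s lerDl sqr_ge0.
- by rewrite /s lerDr sqr_ge0.
by rewrite -mulrDl -mulrDl divff ?gt_eqF // mul1r.
Qed.

(** Minkowski's inequality with a fixed second coordinate. Divided by their norms [A] and [B], both
    pairs become unit vectors; the combined pair is [M] times their convex combination with weights
    [s] and [1 - s], to which convexity of the power applies coordinatewise. *)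
Lemma pnorm_convex (R : realType) (p y t a b : R) : 1 <= p -> 0 < y ->
  0 <= t <= 1 -> 0 <= a -> 0 <= b ->
  pnorm p (t * a + (1 - t) * b) y <= t * pnorm p a y + (1 - t) * pnorm p b y.
Proof.
move=> p1 y0 /andP[t0 t1] a0 b0; have p0 : 0 < p by lra.
have [A eA] : exists A, A = pnorm p a y := ex_intro _ _ erefl.
have [B eB] : exists B, B = pnorm p b y := ex_intro _ _ erefl.
have A0 : 0 < A by rewrite eA pnormC pnorm_gt0.
have B0 : 0 < B by rewrite eB pnormC pnorm_gt0.
rewrite -eA -eB; set M := t * A + _.
have M0 : 0 < M.
  rewrite /M; move: t0; rewrite le_eqVlt => /predU1P[<-|t0].
    by rewrite mul0r add0r subr0 mul1r.
  by rewrite ltr_pwDl ?mulr_gt0 // mulr_ge0 ?(ltW B0) // subr_ge0.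
rewrite pnorm_le_iff ?(ltW M0) //.
pose s := t * A / M.
have s01 : 0 <= s <= 1.
  rewrite divr_ge0 ?mulr_ge0 ?(ltW A0) ?(ltW M0) //= ler_pdivrMr // mul1r.
  by rewrite lerDl mulr_ge0 ?(ltW B0) // subr_ge0.
have s' : 1 - s = (1 - t) * B / M.
  apply/eqP; rewrite subr_eq -mulrDl [_ + t * A]addrC divff // gt_eqF //.
have comb u v : t * u + (1 - t) * v = M * (s * (u / A) + (1 - s) * (v / B)).
  rewrite s' /s; field; rewrite !gt_eqF //.
have key u v : 0 <= u -> 0 <= v -> (t * u + (1 - t) * v) `^ p <=
   M `^ p * (s * (u / A) `^ p + (1 - s) * (v / B) `^ p).
  move=> u0 v0.
  have uA : 0 <= u / A by rewrite divr_ge0 ?(ltW A0).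
  have vB : 0 <= v / B by rewrite divr_ge0 ?(ltW B0).
  have s'0 : 0 <= 1 - s by case/andP: s01 => _; rewrite subr_ge0.
  rewrite comb powRM ?(ltW M0) //; last first.
    by rewrite addr_ge0 // mulr_ge0 //; case/andP: s01.
  by rewrite ler_wpM2l ?powR_ge0 // powR_convex.
have unit u v N : 0 <= u -> 0 <= v -> 0 < N -> N = pnorm p u v ->
    (u / N) `^ p + (v / N) `^ p = 1.
  move=> u0 v0 N0 eN.
  have e w : 0 <= w -> (w / N) `^ p * N `^ p = w `^ p.
    by move=> w0; rewrite -powRM ?divr_ge0 ?(ltW N0) // mulfVK ?gt_eqF.
  have NP : N `^ p != 0 by rewrite gt_eqF ?powR_gt0.
  by apply: (mulIf NP); rewrite mul1r mulrDl !e // eN pnormK.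
have := lerD (key _ _ a0 b0) (key _ _ (ltW y0) (ltW y0)).
have -> : t * y + (1 - t) * y = y by ring.
move=> /le_trans; apply.
rewrite -mulrDr -[leRHS]mulr1 ler_wpM2l ?powR_ge0 //.
have e1 := unit _ _ A a0 (ltW y0) A0 eA.
have e2 := unit _ _ B b0 (ltW y0) B0 eB.
have -> : s * (a / A) `^ p + (1 - s) * (b / B) `^ p + (s * (y / A) `^ p +
  (1 - s) * (y / B) `^ p) = s * ((a / A) `^ p + (y / A) `^ p) +
  (1 - s) * ((b / B) `^ p + (y / B) `^ p) by ring.
by rewrite e1 e2 !mulr1 addrC subrK.
Qed.

Lemma pnorm_increments (R : realType) (p y c d k : R) : 1 <= p -> 0 < y ->
  0 <= c -> c <= d -> 0 <= k ->
  pnorm p d y + pnorm p (c + k) y <= pnorm p c y + pnorm p (d + k) y.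
Proof.
move=> p1 y0; apply: (convex_increments (f := fun x => pnorm p x y)).
by move=> t a b ? ? ?; exact: pnorm_convex.
Qed.

(** Serves the edge joining the two ends of a shift: its degrees change by opposite amounts, and
    convexity of the power favours the less balanced pair. *)
Lemma pnorm_spread (R : realType) (p a c k : R) : 1 <= p ->
  0 <= c -> c <= a -> 0 <= k -> pnorm p a (c + k) <= pnorm p (a + k) c.
Proof.
move=> p1 c0 ca k0; rewrite pnorm_le_iff ?pnorm_ge0 ?pnormK; try lra.
rewrite [leRHS]addrC; apply: (convex_increments (f := fun x => x `^ p)) => //.
by move=> t x y ? ? ?; exact: powR_convex.
Qed.

(** * Shifting neighbours *)

Lemma psomborE (R : realType) n (p : R) (e : rel 'I_n) i j :
  psombor_mx p e i j =
  if e i j then pnorm p (deg e i)%:R (deg e j)%:R else 0.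
Proof. by rewrite mxE. Qed.

Lemma psombor_tr (R : realType) n (p : R) (e : rel 'I_n) : symmetric e ->
  (psombor_mx p e)^T = psombor_mx p e.
Proof.
by move=> se; apply/matrixP => i j; rewrite mxE !psomborE se pnormC.
Qed.

Lemma psombor_ge0 (R : realType) n (p : R) (e : rel 'I_n) i j :
  0 <= psombor_mx p e i j.
Proof. by rewrite psomborE; case: ifP => // _; exact: pnorm_ge0. Qed.

Lemma deg_gt0 n (e : rel 'I_n) i j : e i j -> (0 < deg e i)%N.
Proof. by move=> eij; apply/card_gt0P; exists j; rewrite inE. Qed.

Lemma psombor_gt0 (R : realType) n (p : R) (e : rel 'I_n) i j :
  e i j -> 0 < psombor_mx p e i j.
Proof.
by move=> eij; rewrite psomborE eij pnorm_gt0 // ltr0n (deg_gt0 eij).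
Qed.

(** A zero entry makes its row a vanishing sum of nonnegative terms, so all neighbouring entries are
    zero too; connectedness would then kill the whole vector. *)
Lemma psombor_perron (R : realType) n (p : R) (e : rel 'I_n) :
  (0 < n)%N -> symmetric e -> connected_graph e ->
  exists x : 'I_n -> R, (forall i, 0 < x i) /\
    forall j, \sum_i psombor_mx p e j i * x i = rho (psombor_mx p e) * x j.
Proof.
move=> n0 se ce; have sA := psombor_tr p se.
have [x [x0 xge xA]] := rho_perron sA n0 (psombor_ge0 p e).
have eq j : \sum_i psombor_mx p e j i * x 0 i = rho (psombor_mx p e) * x 0 j.
  have /rowP/(_ j) := xA; rewrite !mxE => <-; apply: eq_bigr => i _.
  by rewrite -{1}sA mxE mulrC.
exists (fun i => x 0 i); split => // i.
rewrite lt0r xge andbT; apply: contraNneq x0 => xi0.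
apply/eqP/rowP => j; rewrite mxE.
have step a b : e a b -> x 0 a = 0 -> x 0 b = 0.
  move=> eab xa0; have := eq a; rewrite xa0 mulr0 => /eqP.
  rewrite psumr_eq0 => [/allP h|c _]; last by rewrite mulr_ge0 ?psombor_ge0.
  have /= := h b (mem_index_enum b).
  by rewrite mulf_eq0 gt_eqF ?psombor_gt0 //= => /eqP.
have /connectP [s] := ce i j.
elim: s i xi0 => [|k s IH] i xi0 /=; first by move=> _ ->.
by move=> /andP[eik pks]; apply: IH => //; exact: step xi0.
Qed.

Lemma rho_lt_of_quad (R : realType) n (p : R) (e e' : rel 'I_n)
    (x y : 'I_n -> R) :
  (0 < n)%N -> symmetric e' -> (forall i, 0 < x i) ->
  (forall j, \sum_i psombor_mx p e j i * x i = rho (psombor_mx p e) * x j) ->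
  \sum_i y i ^+ 2 = \sum_i x i ^+ 2 ->
  \sum_i \sum_j psombor_mx p e i j * x i * x j <
  \sum_i \sum_j psombor_mx p e' i j * y i * y j ->
  rho (psombor_mx p e) < rho (psombor_mx p e').
Proof.
move=> n0 se' x0 xA nxy.
have -> : \sum_i \sum_j psombor_mx p e i j * x i * x j =
          rho (psombor_mx p e) * \sum_i x i ^+ 2.
  rewrite mulr_sumr; apply: eq_bigr => i _.
  transitivity (x i * \sum_j psombor_mx p e i j * x j).
    by rewrite mulr_sumr; apply: eq_bigr => j _; ring.
  by rewrite xA; ring.
move=> /lt_le_trans /(_ (rho_rayleigh y (psombor_tr p se') n0)).
rewrite nxy ltr_pM2r // (bigD1 (Ordinal n0)) //= ltr_pwDl ?exprn_gt0 //.
by apply: sumr_ge0 => i _; rewrite sqr_ge0.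
Qed.

(** Meant for [D] the change of the matrix under a shift: away from [u] and [v] every edge keeps its
    two degrees, hence its weight. *)
Lemma quad_two_rows (R : realType) n (D : 'M[R]_n) (u v : 'I_n) (x : 'I_n -> R) :
  u != v -> D^T = D -> D u u = 0 -> D v v = 0 ->
  (forall i j, i != u -> i != v -> j != u -> j != v -> D i j = 0) ->
  \sum_i \sum_j D i j * x i * x j =
  2 * (x u * x v * D u v +
       \sum_(j | (j != u) && (j != v)) x j * (x u * D u j + x v * D v j)).
Proof.
move=> uv sD Duu Dvv D0.
have sym i j : D i j = D j i by rewrite -{1}sD mxE.
have vu : v != u by rewrite eq_sym.
have row i : \sum_j D i j * x i * x j = D i u * x i * x u + (D i v * x i * x v +
    \sum_(j | (j != u) && (j != v)) D i j * x i * x j).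
  by rewrite (bigD1 u) //= (bigD1 v).
have rest : \sum_(i | (i != u) && (i != v)) \sum_j D i j * x i * x j =
    \sum_(j | (j != u) && (j != v)) x j * (x u * D u j + x v * D v j).
  apply: eq_bigr => i /andP[iu iv]; rewrite row big1 ?addr0.
    by rewrite (sym i u) (sym i v); ring.
  by move=> j /andP[ju jv]; rewrite D0 // !mul0r.
have -> : \sum_i \sum_j D i j * x i * x j =
    \sum_j D u j * x u * x j + (\sum_j D v j * x v * x j +
    \sum_(i | (i != u) && (i != v)) \sum_j D i j * x i * x j).
  by rewrite (bigD1 u) //=; congr (_ + _); rewrite (bigD1 v).
rewrite rest !row Duu Dvv (sym v u).
have -> : \sum_(j | (j != u) && (j != v)) x j * (x u * D u j + x v * D v j) =
  \sum_(j | (j != u) && (j != v)) D u j * x u * x j +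
  \sum_(j | (j != u) && (j != v)) D v j * x v * x j.
  by rewrite -big_split; apply: eq_bigr => j _ /=; ring.
ring.
Qed.

(* N(v) \ N[u]; [shift e u v (excl e v u)] is the full Kelmans shift. *)
Definition excl n (e : rel 'I_n) (v u : 'I_n) : {set 'I_n} :=
  [set j | [&& e v j, ~~ e u j & j != u]].

Definition shift n (e : rel 'I_n) (u v : 'I_n) (S : {set 'I_n}) : rel 'I_n :=
  fun a b => [|| (a == u) && (b \in S), (b == u) && (a \in S) |
    [&& e a b, ~~ ((a == v) && (b \in S)) & ~~ ((b == v) && (a \in S))]].

Section ShiftFacts.
Variables (n : nat) (e : rel 'I_n) (u v : 'I_n) (S : {set 'I_n}).
Hypotheses (ie : irreflexive e) (se : symmetric e) (uv : u != v).
Hypothesis (SE : S \subset excl e v u).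
Let e' := shift e u v S.

Lemma shiftS j : j \in S -> [/\ e v j, ~~ e u j, j != u & j != v].
Proof.
move=> /(fintype.subsetP SE); rewrite inE => /and3P[h1 h2 h3]; split => //.
by apply: contraTneq h1 => ->; rewrite ie.
Qed.

Lemma shift_uS : u \notin S.
Proof. by apply/negP => /shiftS [_ _ /eqP]. Qed.

Lemma shift_vS : v \notin S.
Proof. by apply/negP => /shiftS [_ _ _ /eqP]. Qed.

Lemma shift_sym : symmetric e'.
Proof.
move=> a b; rewrite /e' /shift se orbCA; do 2!congr (_ || _).
by congr (_ && _); rewrite andbC.
Qed.

Lemma shift_irr : irreflexive e'.
Proof.
move=> a; rewrite /e' /shift ie /= orbF orbb; apply/negP => /andP[/eqP->].
by rewrite (negPf shift_uS).
Qed.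

Lemma shiftE_u j : e' u j = e u j || (j \in S).
Proof.
rewrite /e' /shift eqxx /= (negPf shift_uS) (negPf uv) !andbF /= andbT.
by rewrite orbC.
Qed.

Lemma shiftE_v j : e' v j = e v j && (j \notin S).
Proof.
rewrite /e' /shift eqxx /= (negPf shift_vS) [v == u]eq_sym (negPf uv) !andbF.
by rewrite /= andbT.
Qed.

Lemma shiftE_other (i j : 'I_n) : i != u -> i != v -> i \notin S -> e' i j = e i j.
Proof.
move=> iu iv iS; rewrite /e' /shift (negPf iu) (negPf iv) (negPf iS) /= !andbF.
by rewrite andbT.
Qed.

Lemma shiftE_S i j : i \in S -> e' i j = (j == u) || e i j && (j != v).
Proof.
move=> iS; have [_ _ iu iv] := shiftS iS.
by rewrite /e' /shift (negPf iu) (negPf iv) iS /= !andbT.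
Qed.

Lemma deg_shift_u : deg e' u = (deg e u + #|S|)%N.
Proof.
rewrite /deg -cardsUI [X in (_ + X)%N](_ : _ = 0%N) ?addn0.
  by apply: eq_card => j; rewrite !inE shiftE_u.
apply: eq_card0 => j; rewrite !inE; apply/negP => /andP[h /shiftS[_]].
by rewrite h.
Qed.

Lemma deg_shift_v : (deg e' v + #|S|)%N = deg e v.
Proof.
rewrite /deg -(cardsID S [set y | e v y]) addnC; congr (_ + _)%N.
  apply: eq_card => j; rewrite !inE andbC; apply/idP/andP => [h|[]//].
  by case: (shiftS h).
by apply: eq_card => j; rewrite !inE shiftE_v andbC.
Qed.

Lemma deg_shift_other (i : 'I_n) : i != u -> i != v -> deg e' i = deg e i.
Proof.
move=> iu iv; rewrite /deg; have [iS|iS] := boolP (i \in S); last first.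
  by apply: eq_card => j; rewrite !inE shiftE_other.
have [evi /negPf eui _ _] := shiftS iS.
rewrite (cardsD1 u) [RHS](cardsD1 v) !inE shiftE_S // eqxx (se i v) evi.
congr (_ + _)%N; apply: eq_card => j; rewrite !inE shiftE_S //.
by have [->|_] := eqVneq j u; [rewrite /= (se i u) eui andbF | rewrite /= andbC].
Qed.

(** Only edges from [v] to [S] are lost. Their ends remain linked through [u], which is joined to
    [S] and still reaches [v] directly or by the common neighbour [c]; the latter is outside [S],
    since [excl] omits neighbours of [u]. *)
Lemma shift_connected : connected_graph e ->
  e u v \/ (exists2 c, e u c & e v c) -> connected_graph e'.
Proof.
move=> ce near.
have cs : connect_sym e' by apply: sym_connect_sym; exact: shift_sym.
have uv' : connect e' u v.
  case: near => [euv|[c euc evc]]; first by apply: connect1; rewrite shiftE_u euv.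
  have cS : c \notin S by apply/negP => /shiftS [_]; rewrite euc.
  apply: (@connect_trans _ _ c); first by apply: connect1; rewrite shiftE_u euc.
  by rewrite cs; apply: connect1; rewrite shiftE_v evc cS.
have vS j : j \in S -> connect e' v j.
  move=> jS; rewrite cs; apply: (@connect_trans _ _ u); last exact: uv'.
  by apply: connect1; rewrite shiftE_S // eqxx.
have step a b : e a b -> connect e' a b.
  move=> eab; have [|ne] := boolP ((a == v) && (b \in S)).
    by move=> /andP[/eqP-> ?]; exact: vS.
  have [|ne2] := boolP ((b == v) && (a \in S)).
    by move=> /andP[/eqP-> ?]; rewrite cs; exact: vS.
  by apply: connect1; rewrite /e' /shift eab ne ne2 !orbT.
move=> x y; have /connectP[s] := ce x y.
elim: s x => [|k s IH] x /=; first by move=> _ ->.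
move=> /andP[exk pk] hy; exact: connect_trans (step _ _ exk) (IH _ pk hy).
Qed.

End ShiftFacts.

(** * Edge count and bicyclicity of shifted graphs *)

Lemma handshake n (e : rel 'I_n) : irreflexive e -> symmetric e ->
  (\sum_x deg e x = (nedges e).*2)%N.
Proof.
move=> ie se; rewrite /nedges.
pose L := [set xy : 'I_n * 'I_n | e xy.1 xy.2 && (xy.1 < xy.2)%N].
pose U := [set xy : 'I_n * 'I_n | e xy.1 xy.2 && (xy.2 < xy.1)%N].
have -> : (\sum_x deg e x = #|[set xy : 'I_n * 'I_n | e xy.1 xy.2]|)%N.
  rewrite -sum1dep_card; under eq_bigr => x _ do rewrite /deg -sum1dep_card.
  by rewrite pair_big_dep.
have UL : #|U| = #|L|.
  have inj : injective (fun xy : 'I_n * 'I_n => (xy.2, xy.1)).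
    by move=> [a b] [c d] [-> ->].
  rewrite -(card_imset (mem L) inj); apply: eq_card => -[a b].
  rewrite inE /=; apply/idP/imsetP => [h|[[c d]]].
    by exists (b, a) => //; rewrite inE /= se.
  by rewrite inE /= => h [-> ->]; rewrite se.
rewrite -addnn -{1}UL -cardsUI [X in (_ = _ + X)%N](_ : _ = 0%N).
  rewrite addn0; apply: eq_card => -[a b]; rewrite !inE /= -andb_orr.
  by case: (ltngtP b a) => [||/val_inj->]; rewrite ?andbT ?ie.
by apply: eq_card0 => -[a b]; rewrite !inE /=; case: (ltngtP b a); rewrite ?andbF.
Qed.

(** By [handshake] the degree sum determines the edge count, and [u] gains what [v] loses. *)
Lemma shift_bicyclic n (e : rel 'I_n) (u v : 'I_n) (S : {set 'I_n}) :
  bicyclic e -> u != v -> S \subset excl e v u ->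
  e u v \/ (exists2 c, e u c & e v c) -> bicyclic (shift e u v S).
Proof.
move=> [[ie se] ce ne] uv SE near; split.
- by split; [exact: shift_irr ie SE | exact: shift_sym].
- exact: shift_connected.
have := handshake (shift_irr ie SE) (shift_sym u v S se).
have vu : v != u by rewrite eq_sym.
rewrite (bigD1 u) //= (bigD1 v) //= deg_shift_u //.
under eq_bigr => i /andP[iu iv] do rewrite deg_shift_other //.
have := handshake ie se.
rewrite (bigD1 u) //= (bigD1 v) //= ne -(deg_shift_v ie uv SE).
move: (\sum_(i < n | (i != u) && (i != v)) deg e i)%N => T.
move: (deg e u) (#|S|) (deg (shift e u v S) v) (nedges _) => a b c d.
clear; lia.
Qed.

(** * Gain of the quadratic form under a shift *)

Lemma weighted_gain (R : realType) (xu xv a b a' b' : R) : xv <= xu -> 0 < xv ->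
  0 < a - b -> b + a' <= b' + a -> 0 <= xu * (a - b) - xv * (a' - b').
Proof.
move=> xvu x0 ab h; have : 0 <= (xu - xv) * (a - b) by rewrite mulr_ge0 //; lra.
have : 0 <= xv * (b' + a - (b + a')) by rewrite mulr_ge0 ?(ltW x0) //; lra.
nra.
Qed.

(** The change is sorted by vertex. The edge between [u] and [v] gains by [pnorm_spread];
    [excl e v u] is left to the last hypothesis, so that partial shifts are covered; common
    neighbours gain by convexity; neighbours of [u] alone gain strictly. The degree hypothesis says
    that what remains of [v] has degree at most the old [deg e u], the order that both convexity
    arguments require. *)
Lemma shift_quad_lt (R : realType) n (p : R) (e : rel 'I_n) (u v : 'I_n)
    (S : {set 'I_n}) (x : 'I_n -> R) :
  let A := psombor_mx p e in let A' := psombor_mx p (shift e u v S) in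
  1 <= p -> irreflexive e -> symmetric e -> u != v -> S \subset excl e v u ->
  (forall i, 0 < x i) -> x v <= x u -> (0 < #|S|)%N -> (0 < #|excl e u v|)%N ->
  (deg e v <= deg e u + #|S|)%N ->
  0 <= \sum_(j in excl e v u)
     x j * (x u * (A' u j - A u j) + x v * (A' v j - A v j)) ->
  \sum_i \sum_j A i j * x i * x j < \sum_i \sum_j A' i j * x i * x j.
Proof.
move=> A A' p1 ie se uv SE x0 xvu k0 Pn dvu gain.
have p0 : 0 < p by lra.
set e' := shift e u v S in A' gain *.
have ie' : irreflexive e' := shift_irr ie SE.
have se' : symmetric e' := shift_sym u v S se.
rewrite -subr_gt0.
have -> : \sum_i \sum_j A' i j * x i * x j - \sum_i \sum_j A i j * x i * x j =
    \sum_i \sum_j (A' - A) i j * x i * x j.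
  rewrite -sumrB; apply: eq_bigr => i _; rewrite -sumrB; apply: eq_bigr => j _.
  by rewrite !mxE; ring.
have du := deg_shift_u ie uv SE; have dv := deg_shift_v ie uv SE.
have dj j : j != u -> j != v -> deg e' j = deg e j by exact: deg_shift_other.
rewrite -/e' in du dv.
have e'u j : e' u j = e u j || (j \in S) by exact: shiftE_u.
have e'v j : e' v j = e v j && (j \notin S) by exact: shiftE_v.
have AE i j : (A' - A) i j = A' i j - A i j by rewrite !mxE.
rewrite (quad_two_rows (u := u) (v := v)) //; first last.
- move=> i j iu iv ju jv; rewrite AE /A' /A !psomborE !dj //.
  suff -> : e' i j = e i j by rewrite subrr.
  have [iS|iS] := boolP (i \in S); last exact: shiftE_other.
  by rewrite /e' shiftE_S // (negPf ju) jv andbT.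
- by rewrite AE /A' /A !psomborE ie ie' subrr.
- by rewrite AE /A' /A !psomborE ie ie' subrr.
- by rewrite linearB /= /A /A' !psombor_tr.
rewrite pmulr_rgt0 //; set c := deg e' v in dv *.
set k := #|S| in du dv k0 dvu *.
have natle (a b : nat) : (a <= b)%N -> (a%:R : R) <= b%:R by rewrite ler_nat.
have cu : (c%:R : R) <= (deg e u)%:R by apply: natle; move: dvu dv; clear; lia.
have k0R : (0 : R) <= k%:R by [].
apply: ltr_wpDl.
  rewrite mulr_ge0 ?mulr_ge0 ?(ltW (x0 _)) // AE /A' /A !psomborE.
  rewrite e'u (negPf (shift_vS ie SE)) orbF.
  have [euv|_] := boolP (e u v); last by rewrite subr0.
  rewrite subr_ge0 du -dv -/c !natrD; exact: pnorm_spread.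
under eq_bigr do rewrite !AE.
have QE j : j \in excl e v u -> (j != u) && (j != v).
  rewrite inE => /and3P[h _ ->] /=.
  by apply: contraTneq h => ->; rewrite ie.
rewrite (bigID (fun j => j \in excl e v u)) /=.
have -> : \sum_(i | [&& (i != u) && (i != v) & i \in excl e v u])
    x i * (x u * (A' u i - A u i) + x v * (A' v i - A v i)) =
   \sum_(j in excl e v u)
     x j * (x u * (A' u j - A u j) + x v * (A' v j - A v j)).
  by apply: eq_bigl => j; case: (boolP (j \in _)) => [/QE->|]; rewrite ?andbF.
apply: ltr_wpDl => //.
have notS j : j \notin excl e v u -> j \notin S.
  by apply: contraNN => /(fintype.subsetP SE).
have mono j : e u j ->
    0 < pnorm p ((deg e u)%:R + k%:R) (deg e j)%:R - pnorm p (deg e u)%:R (deg e j)%:R.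
  by move=> euj; rewrite subr_gt0 pnorm_lt // ltrDl ltr0n.
have term j : j != u -> j != v -> j \notin excl e v u ->
    x u * (A' u j - A u j) + x v * (A' v j - A v j) =
    (if e u j then x u * (pnorm p ((deg e u)%:R + k%:R) (deg e j)%:R
                          - pnorm p (deg e u)%:R (deg e j)%:R) else 0) -
    (if e v j then x v * (pnorm p (c%:R + k%:R) (deg e j)%:R
                          - pnorm p c%:R (deg e j)%:R) else 0).
  move=> ju jv jQ; have jS := notS j jQ.
  rewrite /A' /A !psomborE e'u e'v (negPf jS) orbF andbT.
  rewrite (dj j) // du -dv -/c !natrD.
  move: (pnorm p _ _) (pnorm p _ _) (pnorm p _ _) (pnorm p _ _) => a b c' d.
  by case: (e u j); case: (e v j); ring.
have vu j : j != u -> j \notin excl e v u -> e v j -> e u j.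
  by move=> ju + evj; rewrite inE evj ju andbT /= negbK.
have term_ge0 j : j != u -> j != v -> j \notin excl e v u ->
    0 <= x u * (A' u j - A u j) + x v * (A' v j - A v j).
  move=> ju jv jQ; rewrite term //.
  have [evj|_] := boolP (e v j); last first.
    rewrite subr0; case: ifP => // euj; rewrite mulr_ge0 ?(ltW (x0 _)) //.
    exact: ltW (mono j euj).
  have euj := vu j ju jQ evj; rewrite euj.
  have d0 : (0 : R) < (deg e j)%:R by rewrite ltr0n (@deg_gt0 _ e j u) // se.
  (* The loss at [v] is an increment of the weight at a smaller degree, hence at most the gain at
     [u], and it is weighted by [x v <= x u]. *)
  refine (weighted_gain xvu (x0 v) (mono j euj) _).
  exact (pnorm_increments p1 d0 (ler0n R c) cu k0R).
have /card_gt0P [w wP] := Pn.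
move: (wP); rewrite inE => /and3P[euw evw wv].
have wu : w != u by apply: contraTneq euw => ->; rewrite ie.
have wQ : w \notin excl e v u by rewrite inE (negPf evw).
rewrite (bigD1 w) /=; last by rewrite wu wv wQ.
apply: ltr_pwDl.
  rewrite mulr_gt0 // term // euw (negPf evw) subr0 mulr_gt0 //; exact: mono.
apply: sumr_ge0 => j /andP[/andP[/andP[ju jv] jQ] _].
by rewrite mulr_ge0 ?(ltW (x0 _)) // term_ge0.
Qed.

Lemma deg_excl n (e : rel 'I_n) (u v : 'I_n) : irreflexive e ->
  deg e v = (#|excl e v u| + #|[set j | e v j && e u j]| + e v u)%N.
Proof.
move=> ie; rewrite /deg -(cardsID (excl e v u) [set y | e v y]) -addnA.
congr (_ + _)%N.
  apply: eq_card => j; rewrite !inE.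
  by case: (e v j); rewrite ?andbF //= ?andbT.
rewrite [LHS](cardsD1 u) !inE eqxx ie /= andbF /= addnC; congr (_ + _)%N.
apply: eq_card => j; rewrite !inE.
have [->|ju] := eqVneq j u; first by rewrite ie andbF.
by case: (e v j); rewrite /= ?andbF ?andbT ?negbK.
Qed.

Lemma deg_excl_le n (e : rel 'I_n) (u v : 'I_n) : irreflexive e -> symmetric e ->
  (deg e v + #|excl e u v| = deg e u + #|excl e v u|)%N.
Proof.
move=> ie se; rewrite (deg_excl u v ie) (deg_excl v u ie) (se u v).
have -> : #|[set j | e u j && e v j]| = #|[set j | e v j && e u j]|.
  by apply: eq_card => j; rewrite !inE andbC.
move: #|_| #|_| #|_| (e v u); clear; lia.
Qed.

(* The two orientations are isomorphic; the Perron vector decides which is handier. *)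
Lemma kelmans_rho_lt (R : realType) n (p : R) (e : rel 'I_n) (u v : 'I_n) :
  1 <= p -> bicyclic e -> u != v ->
  (0 < #|excl e u v|)%N -> (0 < #|excl e v u|)%N ->
  rho (psombor_mx p e) < rho (psombor_mx p (shift e u v (excl e v u))) \/
  rho (psombor_mx p e) < rho (psombor_mx p (shift e v u (excl e u v))).
Proof.
move=> p1 [[ie se] ce _] uv Pn Qn; have p0 : 0 < p by lra.
have n0 : (0 < n)%N by apply: leq_ltn_trans (ltn_ord u).
have [x [x0 xA]] := psombor_perron p n0 se ce.
have main (a b : 'I_n) : a != b -> (0 < #|excl e a b|)%N ->
    (0 < #|excl e b a|)%N -> x b <= x a ->
  rho (psombor_mx p e) < rho (psombor_mx p (shift e a b (excl e b a))).
  move=> ab Pab Pba xba; have SE := fintype.subxx (excl e b a).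
  have ie' := shift_irr ie SE; have se' := shift_sym a b (excl e b a) se.
  apply: (rho_lt_of_quad n0 se' x0 xA (erefl _)).
  have hd := deg_excl_le a b ie se.
  have dab : (deg e b <= deg e a + #|excl e b a|)%N.
    by rewrite -hd leq_addr.
  apply: shift_quad_lt => //.
  apply: sumr_ge0 => j jQ; have [ebj eaj ja jb] := shiftS ie SE jQ.
  rewrite mulr_ge0 ?(ltW (x0 _)) // !psomborE.
  rewrite shiftE_u // shiftE_v // jQ orbT andbF (negPf eaj) ebj.
  rewrite deg_shift_u // (@deg_shift_other _ e a b _ ie se SE j) //.
  rewrite subr0 sub0r mulrN subr_ge0.
  apply: ler_pM; [exact: ltW | exact: pnorm_ge0 | exact: xba | ].
  by apply: pnorm_le => //; rewrite ler_nat.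
have [xvu|/ltW xuv] := leP (x v) (x u); [left|right]; apply: main => //.
by rewrite eq_sym.
Qed.

(** In a convex sequence the next increment bounds all earlier ones; thus a loss over [k] degrees at
    one leaf is paid by [k] equal gains. *)
Lemma telescope_increments (R : realType) (f : nat -> R) (k : nat) :
  (forall i, f i.+1 - f i <= f i.+2 - f i.+1) ->
  f k - f 0%N <= k%:R * (f k.+1 - f k).
Proof.
move=> hf; elim: k => [|k IH]; first by rewrite subrr mul0r.
have k0 : 0 <= k%:R + 1 :> R by rewrite addr_ge0 ?ler0n ?ler01.
have h := ler_wpM2l k0 (hf k); rewrite -natr1.
apply: le_trans h; rewrite mulrDl mul1r.
have -> : f k.+1 - f 0%N = (f k - f 0%N) + (f k.+1 - f k) by ring.
by rewrite lerD2r.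
Qed.

Lemma pnorm_telescope (R : realType) (p y : R) (c k : nat) :
  1 <= p -> 0 < y ->
  pnorm p (c + k)%:R y - pnorm p c%:R y <=
  k%:R * (pnorm p (c + k.+1)%:R y - pnorm p (c + k)%:R y).
Proof.
move=> p1 y0.
have := @telescope_increments R (fun i => pnorm p (c + i)%:R y) k.
rewrite addn0; apply => i.
have le : ((c + i)%:R : R) <= (c + i.+1)%:R by rewrite ler_nat leq_add2l.
have := pnorm_increments p1 y0 (ler0n R (c + i)) le (@ler01 R).
rewrite !natr1 -!addnS.
move: (pnorm p _ y) (pnorm p _ y) (pnorm p _ y); clear => a b d; lra.
Qed.

(* The leaf [q] left behind has the smallest Perron entry; by convexity its loss
   over [k] unit steps is paid by the [k] moved leaves. *)
Lemma broom_rho_lt (R : realType) n (p : R) (e : rel 'I_n) (u v : 'I_n) :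
  1 <= p -> bicyclic e -> u != v ->
  (1 < #|excl e u v|)%N -> (1 < #|excl e v u|)%N ->
  (forall j, j \in excl e u v -> deg e j = 1%N) ->
  (forall j, j \in excl e v u -> deg e j = 1%N) ->
  exists a b q : 'I_n,
   [/\ (a, b) = (u, v) \/ (a, b) = (v, u), q \in excl e b a &
    rho (psombor_mx p e) < rho (psombor_mx p (shift e a b (excl e b a :\ q)))].
Proof.
move=> p1 [[ie se] ce _] uv Pn Qn; have p0 : 0 < p by lra.
have n0 : (0 < n)%N by apply: leq_ltn_trans (ltn_ord u).
have [x [x0 xA]] := psombor_perron p n0 se ce.
have main (a b : 'I_n) : a != b -> (1 < #|excl e a b|)%N ->
    (1 < #|excl e b a|)%N -> (forall j, j \in excl e b a -> deg e j = 1%N) ->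
    x b <= x a -> exists2 q, q \in excl e b a &
  rho (psombor_mx p e) < rho (psombor_mx p (shift e a b (excl e b a :\ q))).
  move=> ab Pab Pba leaf xba.
  have [q0 q0Q] : exists q0, q0 \in excl e b a.
    by apply/card_gt0P; apply: ltn_trans Pba.
  pose q := [arg min_(i < q0 | i \in excl e b a) x i]%O.
  have [qQ qmin] : q \in excl e b a /\ forall j, j \in excl e b a -> x q <= x j.
    by rewrite /q; case: arg_minP.
  exists q => //.
  have SE : excl e b a :\ q \subset excl e b a by exact: subD1set.
  have ie' := shift_irr ie SE; have se' := shift_sym a b (excl e b a :\ q) se.
  apply: (rho_lt_of_quad n0 se' x0 xA (erefl _)).
  have hd := deg_excl_le a b ie se.
  have kQ : #|excl e b a| = #|excl e b a :\ q|.+1 by rewrite (cardsD1 q) qQ.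
  have k0 : (0 < #|excl e b a :\ q|)%N by rewrite -ltnS -kQ.
  have Pab0 : (0 < #|excl e a b|)%N by apply: ltn_trans Pab.
  (* Two private neighbours of [a] make up for the missing [q]: the new degree of [a] strictly
     exceeds the old degree of [b]. *)
  have dab : (deg e b < deg e a + #|excl e b a :\ q|)%N.
    move: hd Pab; rewrite kQ; move: #|_| #|_|; clear; lia.
  have da := deg_shift_u ie ab SE; have db := deg_shift_v ie ab SE.
  have xq := x0 q; have xb := x0 b; have xa := x0 a.
  have y1 : (0 : R) < 1%:R by [].
  have tele := @pnorm_telescope R p 1%:R (deg (shift e a b (excl e b a :\ q)) b)
    #|excl e b a :\ q| p1 y1.
  apply: shift_quad_lt => //; first exact: ltnW.
  rewrite (bigD1 q) //=.
  have [ebq eaq qa qb] := shiftS ie (fintype.subxx _) qQ.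
  have dS j : j != a -> j != b -> deg (shift e a b (excl e b a :\ q)) j = deg e j.
    exact: deg_shift_other.
  have eu j : shift e a b (excl e b a :\ q) a j = e a j || (j \in excl e b a :\ q).
    exact: shiftE_u.
  have ev j : shift e a b (excl e b a :\ q) b j = e b j && (j \notin excl e b a :\ q).
    exact: shiftE_v.
  rewrite [X in X + _](_ : _ = - (x q * (x b *
    (pnorm p (deg e b)%:R 1%:R -
     pnorm p (deg (shift e a b (excl e b a :\ q)) b)%:R 1%:R)))); last first.
    rewrite !psomborE eu ev !in_setD1 eqxx /= (negPf eaq) ebq /= (dS q qa qb) (leaf q qQ).
    move: (pnorm _ _ _) (pnorm _ _ _) (x a) (x b) (x q); clear => *; ring.
  rewrite addrC subr_ge0.
  have [Dl [eDl {}tele]] : exists Dl,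
      Dl = pnorm p (deg e b).+1%:R 1%:R - pnorm p (deg e b)%:R 1%:R /\
      pnorm p (deg e b)%:R 1%:R -
      pnorm p (deg (shift e a b (excl e b a :\ q)) b)%:R 1%:R <=
      #|excl e b a :\ q|%:R * Dl.
    eexists; split; first by [].
    by move: tele; rewrite addnS db.
  apply: (@le_trans _ _ (x q * (x b * (#|excl e b a :\ q|%:R * Dl)))).
    apply: ler_wpM2l; first exact: ltW.
    apply: ler_wpM2l; [exact: ltW | exact: tele].
  rewrite [x b * (_ * Dl)]mulrCA [x q * (_ * _)]mulrCA.
  have -> : #|excl e b a :\ q|%:R * (x q * (x b * Dl)) =
            \sum_(j in excl e b a | j != q) x q * (x b * Dl).
    by rewrite mulr_natl -sumr_const; apply: eq_bigl => j; rewrite in_setD1 andbC.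
  apply: ler_sum => j /andP[jQ jq].
  have [ebj eaj ja jb] := shiftS ie (fintype.subxx _) jQ.
  rewrite !psomborE eu ev !in_setD1 jq jQ /= (negPf eaj) ebj /= (dS j ja jb) (leaf j jQ).
  rewrite subr0 sub0r da.
  have D0 : 0 <= Dl.
    rewrite eDl subr_ge0; apply: pnorm_le; rewrite ?ler_nat //; exact: ltW.
  (* [Dl] is the increment of a leaf weight at the old degree of [b]. Moving the leaf to [a] raises
     its degree by at least one such step, and [x b <= x a]. *)
  apply: (@le_trans _ _ (x j * (x b * Dl))).
    apply: ler_wpM2r; last exact: qmin.
    by apply: mulr_ge0 => //; exact: ltW.
  apply: ler_wpM2l; first exact: ltW.
  rewrite eDl.
  have le1 : pnorm p (deg e b).+1%:R 1%:R <= pnorm p (deg e a + #|excl e b a :\ q|)%:R 1%:R.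
    by apply: pnorm_le; rewrite ?ler_nat ?ler0n //; exact: ltW.
  have w0 := pnorm_ge0 p (deg e a + #|excl e b a :\ q|)%:R 1%:R.
  move: le1 w0 xba xb; move: (pnorm _ _ _) (pnorm _ _ _) (pnorm _ _ _) (x a) (x b).
  clear => w1 w2 w3 xa xb h1 h2 h3 h4; nra.
have [xvu|/ltW xuv] := leP (x v) (x u) => lP lQ.
  have [q qQ h] := main u v uv Pn Qn lQ xvu.
  by exists u, v, q; split => //; left.
have vu : v != u by rewrite eq_sym.
have [q qQ h] := main v u vu Qn Pn lP xuv.
by exists v, u, q; split => //; right.
Qed.

(** * Recognizing labelled graphs *)

Lemma graph_iso_sym n (e1 e2 : rel 'I_n) : graph_iso e1 e2 -> graph_iso e2 e1.
Proof.
move=> [f [[g fg gf] h]]; exists g; split; first by exists f.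
by move=> x y; rewrite h !gf.
Qed.

Lemma deg_iso n (e1 e2 : rel 'I_n) (f : 'I_n -> 'I_n) : bijective f ->
  (forall x y, e1 x y = e2 (f x) (f y)) -> forall x, deg e1 x = deg e2 (f x).
Proof.
move=> bf h x; rewrite /deg -(card_imset _ (bij_inj bf)).
have [g fg gf] := bf; apply: eq_card => y; rewrite inE -{1}(gf y).
rewrite (mem_imset _ _ (bij_inj bf)) inE h gf //.
Qed.

Lemma rho_iso (R : realType) n (p : R) (e1 e2 : rel 'I_n) : graph_iso e1 e2 ->
  rho (psombor_mx p e1) = rho (psombor_mx p e2).
Proof.
have sub (a b : rel 'I_n) : graph_iso a b -> forall r,
    eigenvalue (psombor_mx p b) r -> eigenvalue (psombor_mx p a) r.
  move=> [f [bf h]] r /eigenvalueP [w wB w0].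
  have [g fg gf] := bf.
  apply/eigenvalueP; exists (\row_i w 0 (f i)).
    apply/rowP => j; rewrite [LHS]mxE [RHS]mxE [X in _ = _ * X]mxE.
    have /rowP /(_ (f j)) := wB; rewrite [LHS]mxE [RHS]mxE => <-.
    rewrite [RHS](reindex f) /=; last by exists g => ? _.
    apply: eq_bigr => i _; rewrite [X in X * _ = _]mxE !psomborE h.
    by rewrite (deg_iso bf h i) (deg_iso bf h j).
  apply: contraNneq w0 => /rowP hw; apply/eqP/rowP => i.
  by have := hw (g i); rewrite !mxE gf.
move=> iso; rewrite /rho; congr (sup _); apply/seteqP.
by split=> r /=; apply: sub => //; exact: graph_iso_sym.
Qed.

(** [f] sends a vertex to its position in [s] followed by all other vertices. In the form of an
    equality test it rewrites the numeric tests of an adjacency into tests against named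
    vertices. *)
Lemma relabel n (s : seq 'I_n) : uniq s ->
  exists f : 'I_n -> 'I_n, bijective f /\
    forall i x, (i < size s)%N -> ((f x : nat) == i) = (x == nth x s i).
Proof.
move=> us; pose L := s ++ [seq x <- enum 'I_n | x \notin s].
have memL x : x \in L.
  by rewrite mem_cat mem_filter mem_enum andbT orbN.
have uL : uniq L.
  rewrite cat_uniq us filter_uniq ?enum_uniq // andbT /=; apply/hasPn => x.
  by rewrite mem_filter => /andP[].
have sL : size L = n.
  by rewrite -(card_uniqP uL) -[RHS]card_ord; apply: eq_card => x; rewrite memL.
have fP x : (index x L < n)%N by rewrite -[X in (_ < X)%N]sL index_mem.
exists (fun x => Ordinal (fP x)); split.
  apply: injF_bij => x y [] h.
  by rewrite -(nth_index x (memL x)) h nth_index.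
move=> i x is_ /=; have iL : (i < size L)%N.
  by rewrite size_cat (leq_trans is_) // leq_addr.
have -> : nth x s i = nth x L i by rewrite nth_cat is_.
apply/eqP/eqP => [<-|->]; first by rewrite nth_index.
by rewrite index_uniq.
Qed.

Lemma sym_ofE n (adj : nat -> nat -> bool) (x y : 'I_n) :
  (forall i j, adj i j -> (i < j)%N) ->
  sym_of adj x y = adj x y || adj y x.
Proof.
move=> h; have h' i j : (j <= i)%N -> adj i j = false.
  by move=> ji; apply/negP => /h; rewrite ltnNge ji.
rewrite /sym_of; case: ltngtP => xy.
- by rewrite (h' y x) ?orbF // ltnW.
- by rewrite (h' x y) // ltnW.
- by rewrite -xy !h'.
Qed.

Lemma B1_lt i j : B1adj i j -> (i < j)%N.
Proof. by case/orP => /andP[/eqP-> //] /orP[] /eqP->. Qed.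

Lemma B2_lt i j : B2adj i j -> (i < j)%N.
Proof. by case/orP => [/orP[]|] /andP[/eqP-> // /eqP->]. Qed.

Lemma B3_lt i j : B3adj i j -> (i < j)%N.
Proof. by case/orP => [/andP[/andP[/eqP->]]|/andP[/eqP->]] // /or3P[] /eqP->. Qed.

(* u = 0, b = 1, b' = 2, w = 3; the remaining vertices are pendant at u. *)
Definition kite_adj (i j : nat) : bool :=
  [|| [&& i == 0%N, 1 <= j & j != 3]%N,
      (i == 1%N) && ((j == 2%N) || (j == 3%N)) | (i == 2%N) && (j == 3%N)].

Definition kite n : rel 'I_n := @sym_of n kite_adj.
Arguments kite n : clear implicits.

Lemma kite_lt i j : kite_adj i j -> (i < j)%N.
Proof.
case/or3P => [/and3P[/eqP->]|/andP[/eqP->]|/andP[/eqP-> /eqP->]] //.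
by case/orP => /eqP->.
Qed.

(** Deletion of [u] that keeps the vertex type: [u] becomes isolated, so deletions can be iterated
    and the edge counts of the stages compared. *)
Definition avoid n (e : rel 'I_n) (u : 'I_n) : rel 'I_n :=
  fun x y => [&& e x y, x != u & y != u].

Lemma avoid_irr n (e : rel 'I_n) u : irreflexive e -> irreflexive (avoid e u).
Proof. by move=> ie x; rewrite /avoid ie. Qed.

Lemma avoid_sym n (e : rel 'I_n) u : symmetric e -> symmetric (avoid e u).
Proof. by move=> se x y; rewrite /avoid se; congr (_ && _); rewrite andbC. Qed.

Lemma nedges_avoid n (e : rel 'I_n) u : irreflexive e -> symmetric e ->
  nedges e = (deg e u + nedges (avoid e u))%N.
Proof.
move=> ie se.
have h1 := handshake ie se.
have h2 := handshake (avoid_irr u ie) (avoid_sym u se).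
have du : deg (avoid e u) u = 0%N.
  by apply: eq_card0 => y; rewrite !inE /avoid eqxx andbF.
have dx x : x != u -> deg e x = (deg (avoid e u) x + e u x)%N.
  move=> xu; rewrite /deg (cardsD1 u) inE addnC (se x u); congr (_ + _)%N.
  by apply: eq_card => y; rewrite !inE /avoid xu andbC.
have s1 : (\sum_(x | x != u) e u x = deg e u)%N.
  rewrite /deg -sum1_card [RHS]big_mkcond [RHS](bigD1 u) //= inE ie add0n.
  by apply: eq_bigr => x _; rewrite inE; case: (e u x).
move: h1 h2; rewrite (bigD1 u) //= [in X in _ -> X -> _](bigD1 u) //= du.
rewrite (eq_bigr _ dx) big_split /= s1.
move: (\sum_(_ < n | _) _)%N (nedges _) (nedges _) (deg _ _); clear; lia.
Qed.

Lemma nedges0 n (e : rel 'I_n) x y : irreflexive e -> symmetric e ->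
  nedges e = 0%N -> e x y = false.
Proof.
move=> ie se ne; apply/negP => exy; have := nedges_avoid x ie se.
by have := deg_gt0 exy; rewrite ne; case: (deg e x).
Qed.

Lemma adj_avoid n (e : rel 'I_n) (u x y : 'I_n) : irreflexive e -> symmetric e ->
  e x y = [|| (x == u) && e u y, (y == u) && e u x | avoid e u x y].
Proof.
move=> ie se; rewrite /avoid.
have [->|xu] := eqVneq x u; first by rewrite ie !andbF orbF /= orbF.
have [->|yu] := eqVneq y u; first by rewrite /= andbF orbF se.
by rewrite /= andbT.
Qed.

Lemma iso_B1 n (e : rel 'I_n) (u v s t : 'I_n) :
  irreflexive e -> symmetric e -> uniq [:: u; v; s; t] ->
  (forall x, e u x = (x != u)) ->
  (forall x y, avoid e u x y =
     (x == v) && ((y == s) || (y == t)) || (y == v) && ((x == s) || (x == t))) ->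
  graph_iso e (B1 n).
Proof.
move=> ie se us eu av; have [f [bf hf]] := relabel us.
exists f; split => // x y.
rewrite (adj_avoid u) // !eu av /B1 sym_ofE; last exact: B1_lt.
rewrite /B1adj !lt0n.
rewrite !(hf 0%N) ?(hf 1%N) ?(hf 2%N) ?(hf 3%N) //=.
case: (x == u); case: (y == u) => //=; rewrite ?orbT ?orbF //.
Qed.

Lemma iso_B2 n (e : rel 'I_n) (u a b c d : 'I_n) :
  irreflexive e -> symmetric e -> uniq [:: u; a; b; c; d] ->
  (forall x, e u x = (x != u)) ->
  (forall x y, avoid e u x y =
     [|| (x == a) && (y == b), (y == a) && (x == b),
         (x == c) && (y == d) | (y == c) && (x == d)]) ->
  graph_iso e (B2 n).
Proof.
move=> ie se us eu av; have [f [bf hf]] := relabel us.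
exists f; split => // x y.
rewrite (adj_avoid u) // !eu av /B2 sym_ofE; last exact: B2_lt.
rewrite /B2adj !lt0n.
rewrite !(hf 0%N) ?(hf 1%N) ?(hf 2%N) ?(hf 3%N) ?(hf 4%N) //=.
move: (x == u) (y == u) (x == a) (y == a) (x == b) (y == b) (x == c) (y == c).
move: (x == d) (y == d); by do 10!case.
Qed.

Lemma iso_B3 n (e : rel 'I_n) (u v s t w : 'I_n) :
  irreflexive e -> symmetric e -> uniq [:: u; v; s; t; w] ->
  (forall x, e u x = (x != u) && (x != w)) ->
  (forall x y, avoid e u x y =
     (x == v) && [|| y == s, y == t | y == w] ||
     (y == v) && [|| x == s, x == t | x == w]) ->
  graph_iso e (B3 n).
Proof.
move=> ie se us eu av; have [f [bf hf]] := relabel us.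
exists f; split => // x y.
rewrite (adj_avoid u) // !eu av /B3 sym_ofE; last exact: B3_lt.
rewrite /B3adj !lt0n.
rewrite !(hf 0%N) ?(hf 1%N) ?(hf 2%N) ?(hf 3%N) ?(hf 4%N) //=.
move: [|| y == s, y == t | y == w] [|| x == s, x == t | x == w].
move: (x == u) (y == u) (x == v) (y == v) (x == w) (y == w); by do 8!case.
Qed.

Lemma iso_kite n (e : rel 'I_n) (u b b' w : 'I_n) :
  irreflexive e -> symmetric e -> uniq [:: u; b; b'; w] ->
  (forall x, e u x = (x != u) && (x != w)) ->
  (forall x y, avoid e u x y =
     [|| (x == b) && ((y == b') || (y == w)), (y == b) && ((x == b') || (x == w)),
         (x == b') && (y == w) | (y == b') && (x == w)]) ->
  graph_iso e (kite n).
Proof.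
move=> ie se us eu av; have [f [bf hf]] := relabel us.
exists f; split => // x y.
rewrite (adj_avoid u) // !eu av /kite sym_ofE; last exact: kite_lt.
rewrite /kite_adj !lt0n.
rewrite !(hf 0%N) ?(hf 1%N) ?(hf 2%N) ?(hf 3%N) //=.
move: (x == u) (y == u) (x == b) (y == b) (x == b') (y == b') (x == w) (y == w).
by do 8!case.
Qed.

Lemma two_edges n (g : rel 'I_n) : irreflexive g -> symmetric g ->
  nedges g = 2%N ->
  exists a b c d : 'I_n, [/\ g a b, g c d, a != b, c != d &
   ~~ ((a == c) && (b == d)) /\ ~~ ((a == d) && (b == c)) /\
   forall x y, g x y =
     [|| (x == a) && (y == b), (y == a) && (x == b),
         (x == c) && (y == d) | (y == c) && (x == d)]].
Proof.
move=> ig sg /eqP/cards2P [[a b] [[c d] [ne P2]]].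
have gE x y : g x y && (x < y)%N = (x == a) && (y == b) || (x == c) && (y == d).
  by have := in_set2 (x, y) (a, b) (c, d); rewrite -P2 inE /= => ->.
have /andP [gab ab] : g a b && (a < b)%N by rewrite gE !eqxx.
have /andP [gcd cd] : g c d && (c < d)%N by rewrite gE !eqxx orbT.
exists a, b, c, d; split => //.
- by rewrite neq_ltn ab.
- by rewrite neq_ltn cd.
split; first by move: ne; rewrite xpair_eqE.
split.
  apply/negP => /andP[/eqP ad /eqP bc]; move: ab cd; rewrite ad bc => h1 h2.
  by have := ltn_trans h1 h2; rewrite ltnn.
move=> x y; case: (ltngtP x y) => [xy|yx|/val_inj ->].
- have := gE x y; rewrite xy andbT => ->.
  have h (p q : 'I_n) : (p < q)%N -> (y == p) && (x == q) = false.
    move=> pq; apply/negP => /andP[/eqP yp /eqP xq]; move: xy.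
    by rewrite yp xq ltnNge (ltnW pq).
  by rewrite !h // orbF.
- have := gE y x; rewrite yx andbT sg => ->.
  have h (p q : 'I_n) : (p < q)%N -> (x == p) && (y == q) = false.
    move=> pq; apply/negP => /andP[/eqP yp /eqP xq]; move: yx.
    by rewrite yp xq ltnNge (ltnW pq).
  by rewrite !h.
- rewrite ig; apply/esym/negP.
  have h (p q : 'I_n) : (p < q)%N -> (y == p) && (y == q) = false.
    move=> pq; apply/negP => /andP[/eqP yp /eqP xq]; move: pq.
    by rewrite -yp -xq ltnn.
  by rewrite !h.
Qed.

(** A universal vertex has degree [n - 1], which leaves two edges off it: if they meet the graph is
    B1, otherwise B2. [star] serves the four ways of meeting. *)
Lemma universal_iso n (e : rel 'I_n) (u : 'I_n) : bicyclic e ->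
  (forall x, x != u -> e u x) -> graph_iso e (B1 n) \/ graph_iso e (B2 n).
Proof.
move=> [[ie se] ce ne] univ.
have eu x : e u x = (x != u).
  by have [->|/univ] := eqVneq x u; rewrite ?ie.
have du : (deg e u).+1 = n.
  rewrite -[RHS](card_ord n) (cardD1 u) inE /= add1n; congr _.+1.
  by apply: eq_card => y; rewrite !inE eu andbT.
have n2 : nedges (avoid e u) = 2%N.
  by have := nedges_avoid u ie se; move: du; rewrite ne; move: (deg _ _) (nedges _); clear; lia.
have [a [b [c [d [gab gcd ab cd [ne1 [ne2 gE]]]]]]] :=
  two_edges (avoid_irr u ie) (avoid_sym u se) n2.
have gu x y : avoid e u x y -> (x != u) && (y != u) by case/and3P => _ -> ->.
have /andP [au bu] := gu _ _ gab; have /andP [cu du'] := gu _ _ gcd.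
have star v s t : uniq [:: u; v; s; t] ->
    (forall x y, avoid e u x y =
     [|| (x == v) && (y == s), (y == v) && (x == s),
         (x == v) && (y == t) | (y == v) && (x == t)]) -> graph_iso e (B1 n).
  move=> us h; apply: (iso_B1 ie se us eu) => x y; rewrite h.
  move: (x == v) (y == v) (x == s) (y == s) (x == t) (y == t); by do 6!case.
have [ac|ac] := eqVneq a c.
  subst c; left; apply: (star a b d) => //=.
  by move: ne1; rewrite eqxx /= !inE !negb_or !(eq_sym u) au bu du' ab cd => ->.
have [ad|ad] := eqVneq a d.
  subst d; left; apply: (star a b c) => [|x y] /=.
    by move: ne2; rewrite eqxx /= !inE !negb_or !(eq_sym u) (eq_sym a c) au bu cu ab cd => ->.
  by rewrite gE; congr [|| _, _ | _]; rewrite orbC andbC [in X in _ || X]andbC.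
have [bc|bc] := eqVneq b c.
  subst c; left; apply: (star b a d) => [|x y] /=.
    by rewrite !inE !negb_or !(eq_sym u) (eq_sym b a) au bu du' ab cd ad.
  by rewrite gE orbCA; congr [|| _, _ | _]; rewrite andbC.
have [bd|bd] := eqVneq b d.
  subst d; left; apply: (star b a c) => [|x y] /=.
    by rewrite !inE !negb_or !(eq_sym u) (eq_sym b a) au bu cu ab ac bc.
  rewrite gE orbCA; congr [|| _, _ | _]; try by rewrite andbC.
  by rewrite orbC; congr (_ || _); rewrite andbC.
right; apply: (iso_B2 ie se _ eu gE).
by rewrite /= !inE !negb_or !(eq_sym u) au bu cu du' ab ac ad bc bd cd.
Qed.

(** * Bicyclic graphs without improving shift *)

Definition nonuniv n (e : rel 'I_n) : Prop :=
  forall x, exists2 y, y != x & ~~ e x y.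

Definition improvable (R : realType) n (p : R) (e : rel 'I_n) : Prop :=
  exists e' : rel 'I_n, [/\ bicyclic e', nonuniv e' &
    rho (psombor_mx p e) < rho (psombor_mx p e')].

(** Apart from [u], no vertex gains a neighbour without losing one, so only [u] needs a new witness,
    namely [y]. *)
Lemma shift_nonuniv n (e : rel 'I_n) (u v y : 'I_n) (S : {set 'I_n}) :
  irreflexive e -> u != v -> S \subset excl e v u -> nonuniv e ->
  y != u -> ~~ e u y -> y \notin S -> nonuniv (shift e u v S).
Proof.
move=> ie uv SE nu yu euy yS z.
have [->|zu] := eqVneq z u.
  by exists y => //; rewrite shiftE_u // (negPf euy) (negPf yS).
have [->|zv] := eqVneq z v.
  have [w wv evw] := nu v; exists w => //.
  by rewrite shiftE_v // (negPf evw).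
have [zS|zS] := boolP (z \in S).
  exists v; first by rewrite eq_sym.
  by rewrite shiftE_S // eqxx andbF orbF eq_sym.
by have [w wz ezw] := nu z; exists w => //; rewrite shiftE_other.
Qed.

(** Adjacency or a common neighbour preserves connectedness. The last hypothesis provides, for
    either direction of the shift, a non-neighbour of the target: the other end itself, or a vertex
    that sees neither. *)
Lemma kelmans_improvable (R : realType) n (p : R) (e : rel 'I_n) (u v : 'I_n) :
  1 <= p -> bicyclic e -> nonuniv e -> u != v ->
  (0 < #|excl e u v|)%N -> (0 < #|excl e v u|)%N ->
  e u v \/ (exists2 c, e u c & e v c) ->
  ~~ e u v \/ (exists y, [/\ y != u, y != v, ~~ e u y & ~~ e v y]) ->
  improvable p e.
Proof.
move=> p1 be nu uv Pn Qn near gap; have [[ie se] _ _] := be.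
have vu : v != u by rewrite eq_sym.
have nonu a b : a != b -> ~~ e a b \/
    (exists y, [/\ y != a, y != b, ~~ e a y & ~~ e b y]) ->
    nonuniv (shift e a b (excl e b a)).
  move=> ab [eab|[y [ya yb eay eby]]].
    by apply: (@shift_nonuniv _ _ _ _ b); rewrite ?inE ?ie // eq_sym.
  by apply: (@shift_nonuniv _ _ _ _ y); rewrite ?inE ?(negPf eby).
have [h|h] := kelmans_rho_lt p1 be uv Pn Qn.
  exists (shift e u v (excl e v u)); split => //; last exact: nonu.
  exact: shift_bicyclic.
exists (shift e v u (excl e u v)); split => //.
  apply: shift_bicyclic => //; case: near => [euv|[c h1 h2]].
    by left; rewrite se.
  by right; exists c.
apply: nonu => //; case: gap => [euv|[y [h1 h2 h3 h4]]].
  by left; rewrite se.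
by right; exists y.
Qed.

(** Here a full shift could make the target universal; the leaf left behind remains as its
    non-neighbour. *)
Lemma broom_improvable (R : realType) n (p : R) (e : rel 'I_n) (u v : 'I_n) :
  1 <= p -> bicyclic e -> nonuniv e -> u != v -> e u v ->
  (1 < #|excl e u v|)%N -> (1 < #|excl e v u|)%N ->
  (forall j, j \in excl e u v -> deg e j = 1%N) ->
  (forall j, j \in excl e v u -> deg e j = 1%N) -> improvable p e.
Proof.
move=> p1 be nu uv euv Pn Qn lP lQ; have [[ie se] _ _] := be.
have [a [b [q [ab qQ h]]]] := broom_rho_lt p1 be uv Pn Qn lP lQ.
have [eab nab] : e a b /\ a != b.
  by case: ab => -[-> ->]; [| rewrite se eq_sym].
have SE : excl e b a :\ q \subset excl e b a by exact: subD1set.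
exists (shift e a b (excl e b a :\ q)); split => //.
  by apply: shift_bicyclic => //; left.
have [ebq eaq qa qb] := shiftS ie (fintype.subxx _) qQ.
by apply: (@shift_nonuniv _ _ _ _ q); rewrite ?in_setD1 ?eqxx.
Qed.

Lemma deg_ge_card n (e : rel 'I_n) (b : 'I_n) (S : {set 'I_n}) :
  (forall j, j \in S -> e b j) -> (#|S| <= deg e b)%N.
Proof.
by move=> h; apply: subset_leq_card; apply/fintype.subsetP => j /h; rewrite inE.
Qed.

Lemma deg_eq_card n (e : rel 'I_n) (b : 'I_n) (S : {set 'I_n}) :
  (forall j, j \in S -> e b j) -> deg e b = #|S| -> forall j, e b j = (j \in S).
Proof.
move=> h hc j; have sub : S \subset [set y | e b y].
  by apply/fintype.subsetP => y /h; rewrite inE.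
by have := (subset_cardP (esym hc) sub) j; rewrite inE.
Qed.

Lemma cover_card n (s : seq 'I_n) (A B : {set 'I_n}) :
  (forall z, z \notin s -> (z \in A) || (z \in B)) ->
  (n <= size s + #|A| + #|B|)%N.
Proof.
move=> h; rewrite -{1}(card_ord n).
apply: leq_trans (_ : #|[set x in s] :|: A :|: B| <= _)%N.
  apply: subset_leq_card; apply/fintype.subsetP => z _; rewrite !inE -orbA.
  by have [//|/h] := boolP (z \in s).
apply: leq_trans (leq_card_setU _ _) _; rewrite leq_add2r.
apply: leq_trans (leq_card_setU _ _) _; rewrite leq_add2r.
by rewrite cardsE card_size.
Qed.

(* [u] has maximal degree and [X] is the set of vertices outside N[u]; [nedges_avoid]
   leaves only |X| + 2 edges off [u]. *)
Lemma classify (R : realType) n (p : R) (e : rel 'I_n) :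
  1 <= p -> (6 <= n)%N -> bicyclic e -> nonuniv e -> ~ improvable p e ->
  graph_iso e (B3 n) \/ graph_iso e (kite n).
Proof.
move=> p1 n6 be nu nimp; have [[ie se] ce ne] := be.
have n0 : (0 < n)%N by apply: leq_trans n6.
(* Non-adjacent vertices with a common neighbour have nested neighbourhoods. *)
have clo_a a b c x y : ~~ e a b -> a != b -> e a c -> e b c ->
    e a x -> ~~ e b x -> e b y -> ~~ e a y -> False.
  move=> eab ab eac ebc eax ebx eby eay; apply: nimp.
  apply: (kelmans_improvable p1 be nu ab).
  - apply/card_gt0P; exists x; rewrite inE eax ebx /=.
    by apply: contraNneq eab => <-.
  - apply/card_gt0P; exists y; rewrite inE eby eay /=.
    by apply: contraNneq eab => <-; rewrite se.
  - by right; exists c.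
  - by left.
(* Adjacent vertices with incomparable neighbourhoods jointly see every vertex, since an unseen one
   would permit a shift within the class. *)
have clo_b a b x y : e a b -> e a x -> ~~ e b x -> x != b ->
    e b y -> ~~ e a y -> y != a -> forall z, [|| z == a, z == b, e a z | e b z].
  move=> eab eax ebx xb eby eay ya z; apply/negPn/negP.
  rewrite !negb_or => /and4P[za zb eaz ebz]; apply: nimp.
  have ab : a != b by apply: contraTneq eab => ->; rewrite ie.
  apply: (kelmans_improvable p1 be nu ab).
  - by apply/card_gt0P; exists x; rewrite inE eax ebx xb.
  - by apply/card_gt0P; exists y; rewrite inE eby eay ya.
  - by left.
  - by right; exists z.
have [u umax] : exists u, forall v, (deg e v <= deg e u)%N.
  pose u := [arg max_(i > Ordinal n0) deg e i].
  by exists u => v; rewrite /u; case: arg_maxnP => // i _; apply.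
pose X := [set x | (x != u) && ~~ e u x].
have XP x : x \in X -> x != u /\ ~~ e u x by rewrite inE => /andP.
have Xnb x y : x \in X -> e u y -> x != y.
  by move=> /XP[_ h] euy; apply: contraNneq h => ->.
(* By maximality of its degree, [u] has at least as many private neighbours against [b] as [b] has
   against [u]. *)
have excl_u b : (0 < #|excl e b u|)%N -> exists y, y \in excl e u b.
  move=> h; apply/card_gt0P; have := deg_excl_le u b ie se; have := umax b.
  move: (deg _ _) (deg _ _) #|_| #|_| h; clear; lia.
(* By [clo_b] on the edge from [u] to [b], a neighbour of [u] that meets [X] is joined to all of
   [X]. With [F2] and [F3], [X] is independent and its vertices share one neighbourhood, contained
   in that of [u]. *)
have F1 b x x' : e u b -> x \in X -> e b x -> x' \in X -> e b x'.
  move=> eub xX ebx x'X; have [xu eux] := XP x xX; have [x'u eux'] := XP x' x'X.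
  have xin : x \in excl e b u by rewrite inE ebx eux xu.
  have [y] := excl_u b (introT card_gt0P (ex_intro _ x xin)).
  rewrite inE => /and3P[euy eby yb].
  have := clo_b u b y x eub euy eby yb ebx eux xu x'.
  by rewrite (negPf x'u) (negPf eux') (negPf (Xnb _ _ x'X eub)).
have [b [x0 [eub x0X ebx0]]] : exists b x0, [/\ e u b, x0 \in X & e b x0].
  apply: contrapT => no.
  have [x xu eux] := nu u.
  have /connectP [s ps xE] := ce u x.
  have stay a t : (a == u) || e u a -> path e a t ->
      all (fun z => (z == u) || e u z) (a :: t).
    elim: t a => [|z t IH] a /= ha; first by rewrite ha.
    move=> /andP[eaz pz]; rewrite ha /=; apply: (IH z _ pz).
    apply/negPn/negP; rewrite negb_or => /andP[zu euz]; apply: no.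
    case/orP: ha => [/eqP au|eua]; first by move: euz; rewrite -au eaz.
    by exists a, z; rewrite inE zu euz.
  have /allP /(_ x) : all (fun z => (z == u) || e u z) (u :: s).
    by apply: stay => //; rewrite eqxx.
  rewrite xE mem_last => /(_ isT).
  by rewrite -xE (negPf xu) (negPf eux).
have F2 x y : x \in X -> e x y -> e u y.
  move=> xX exy; apply/negPn/negP => euy; have [xu eux] := XP x xX.
  have ebx := F1 b x0 x eub x0X ebx0 xX.
  have yu : y != u by apply: contraTneq exy => ->; rewrite se.
  have yin : y \in excl e x u by rewrite inE exy euy yu.
  have [z] := excl_u x (introT card_gt0P (ex_intro _ y yin)).
  rewrite inE => /and3P[euz exz zx].
  by apply: (clo_a u x b z y); rewrite // 1?eq_sym // se.
have F3 x x' y : x \in X -> x' \in X -> e x y -> e x' y.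
  move=> xX x'X exy; rewrite se; apply: (F1 y x) => //; last by rewrite se.
  exact: F2 xX exy.
pose g := avoid e u.
have ig : irreflexive g := avoid_irr u ie.
have sg : symmetric g := avoid_sym u se.
have gE x y : x != u -> y != u -> g x y = e x y.
  by move=> xu yu; rewrite /g /avoid xu yu !andbT.
have m0 : (0 < #|X|)%N by apply/card_gt0P; exists x0.
have nX : n = (deg e u + #|X|).+1.
  rewrite -[LHS](card_ord n) [LHS](cardD1 u) inE /= add1n; congr _.+1.
  rewrite /deg -cardsUI [X in (_ + X)%N](_ : _ = 0%N) ?addn0.
    apply: eq_card => y; rewrite !inE andbT.
    by have [->|yu] := eqVneq y u; rewrite ?ie //= orbN.
  by apply: eq_card0 => y; rewrite !inE; case: (e u y); rewrite ?andbF.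
have ng : nedges g = #|X|.+2.
  have := nedges_avoid u ie se; rewrite ne -/g; move: nX.
  move: (deg _ _) #|_| (nedges _); clear; lia.
have nbu y : e u y -> y != u by apply: contraTneq => ->; rewrite ie.
have Ng1 b1 c y : y \in X -> e b1 y -> e u b1 -> e u c -> b1 != c -> avoid g c b1 y.
  move=> yX eby eub1 euc bc; have [yu euy] := XP y yX.
  by rewrite /avoid bc (Xnb _ _ yX euc) gE ?eby ?(nbu b1) // yu.
have Ng b1 y : y \in X -> e b1 y -> e u b1 -> g b1 y.
  by move=> yX eby eub1; have [yu _] := XP y yX; rewrite gE // nbu.
(* If [b1] and [b2] were not adjacent, [x] and [b1] would jointly see everything. This costs at
   least [n - 3] edges off [u] at [b1] or [x], besides [#|X|] at [b2], against a total of
   [#|X| + 2]; [6 <= n] forbids it. *)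
have caseA b1 b2 x : x \in X -> e x b1 -> e x b2 -> b1 != b2 -> e b1 b2.
  move=> xX exb1 exb2 b12; apply/negPn/negP => eb12.
  have eub1 := F2 _ _ xX exb1; have eub2 := F2 _ _ xX exb2.
  have [xu eux] := XP x xX; have ux : u != x by rewrite eq_sym.
  have b21 : b2 != b1 by rewrite eq_sym.
  have cov := clo_b x b1 b2 u exb1 exb2 eb12 b21.
  rewrite se eub1 se eux ux in cov.
  have {}cov := cov isT isT isT.
  pose g1 := avoid g b1; pose g2 := avoid g1 b2.
  have ig1 : irreflexive g1 := avoid_irr b1 ig.
  have sg1 : symmetric g1 := avoid_sym b1 sg.
  have ig2 : irreflexive g2 := avoid_irr b2 ig1.
  have sg2 : symmetric g2 := avoid_sym b2 sg1.
  have e1 := nedges_avoid b1 ig sg; have e2 := nedges_avoid b2 ig1 sg1.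
  have e3 := nedges_avoid x ig2 sg2.
  have c1 : (#|X| <= deg g1 b2)%N.
    apply: deg_ge_card => y yX; apply: Ng1 => //.
    by rewrite se; apply: (F3 x).
  have c2 : (n <= 3 + deg g b1 + deg g2 x)%N.
    apply: (@cover_card _ [:: u; b1; b2]) => z.
    rewrite !inE !negb_or => /and3P[zu zb1 zb2].
    rewrite gE ?(nbu _ eub1) // /g2 /g1 /avoid gE // zb1 zb2 (Xnb _ _ xX eub1).
    rewrite (Xnb _ _ xX eub2) !andbT.
    have := cov z; rewrite (negPf zb1) /=; case/or3P => [/eqP ->||].
    - by rewrite se exb1.
    - by move=> ->; rewrite orbT.
    - by move=> ->.
  move: e1 e2 e3 c1 c2 n6; rewrite -/g1 -/g2 ng.
  move: (deg _ _) (deg _ _) (deg _ _) (nedges _) (nedges _) (nedges _) #|_|.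
  clear; lia.
have bu : b != u := nbu _ eub.
have ebX y : y \in X -> e b y by move=> yX; apply: (F1 b x0).
pose g1 := avoid g b.
have ig1 : irreflexive g1 := avoid_irr b ig.
have sg1 : symmetric g1 := avoid_sym b sg.
have e1 := nedges_avoid b ig sg.
rewrite -/g1 ng in e1.
have Xg y : y \in X -> g b y by move=> yX; apply: Ng => //; exact: ebX.
have Xu y : y \in X -> (y == u) = false by move=> /XP[/negPf].
(* A second neighbour [b'] of [x0] costs [#|X| + 1] edges at [b] and [#|X|] more at [b']. The total
   [#|X| + 2] forces [#|X| = 1] and leaves no other edge: the kite. *)
have [[b' [x0b' bb']]|only] := pselect (exists b', e x0 b' /\ b != b').
  right; have eub' := F2 _ _ x0X x0b'.
  have b'u := nbu _ eub'.
  have b'X : b' \notin X by apply/negP => /XP[_]; rewrite eub'.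
  have ebb' : e b b' by apply: (caseA b b' x0) => //; rewrite se.
  pose g2 := avoid g1 b'.
  have e2 := nedges_avoid b' ig1 sg1; rewrite -/g2 in e2.
  have sub1 j : j \in b' |: X -> g b j.
    by rewrite in_setU1 => /orP[/eqP->|/Xg//]; rewrite gE.
  have sub2 j : j \in X -> g1 b' j.
    move=> jX; apply: Ng1 => //; last by rewrite eq_sym.
    by rewrite se; apply: (F3 x0).
  have c1 := deg_ge_card sub1; have c2 := deg_ge_card sub2.
  rewrite cardsU1 b'X add1n in c1.
  have [mE d1 d2 n2] : [/\ #|X| = 1%N, deg g b = 2%N, deg g1 b' = 1%N & nedges g2 = 0%N].
    move: e1 e2 c1 c2 m0; move: (deg _ _) (deg _ _) (nedges _) (nedges _) #|_|; clear.
    by move=> *; split; lia.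
  have XE : X = [set x0].
    by apply/esym/eqP; rewrite eqEcard finset.sub1set x0X mE cards1.
  have gb : forall j, g b j = (j \in b' |: X).
    by apply: deg_eq_card => //; rewrite cardsU1 b'X mE.
  have g1b' : forall j, g1 b' j = (j \in X) by apply: deg_eq_card => //; rewrite mE.
  have euE x : e u x = (x != u) && (x != x0).
    have : (x \in X) = (x == x0) by rewrite XE inE.
    by rewrite inE; have [->|xu] := eqVneq x u; rewrite ?ie //= => <-; rewrite negbK.
  apply: (@iso_kite _ _ u b b' x0) => //.
    rewrite /= !inE !negb_or !(eq_sym u) bu b'u (Xu _ x0X) bb' !(eq_sym _ x0).
    by rewrite (Xnb _ _ x0X eub) (Xnb _ _ x0X eub').
  move=> x y; rewrite -/g (adj_avoid b) // -/g1 (adj_avoid b' (e := g1)) // -/g2.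
  have -> : g2 x y = false.
    exact: nedges0 (avoid_irr b' ig1) (avoid_sym b' sg1) n2.
  rewrite !gb !g1b' XE !inE orbF.
  move: (x == b) (y == b) (x == b') (y == b') (x == x0) (y == x0); by do 6!case.
have Nx x y : x \in X -> e x y -> y = b.
  move=> xX exy; apply/eqP; apply: contrapT => /negP yb; apply: only.
  by exists y; split; [apply: (F3 x) | rewrite eq_sym].
have bNX : b \notin X by apply/negP => /XP[_]; rewrite eub.
(* Here [b] would already have [#|X| + 2] edges off [u], and the edge from [c] to [d] is one too
   many. *)
have two c d : g1 c d -> ~~ (e b c && e b d).
  move=> gcd; apply/negP => /andP[ebc ebd].
  have /and3P[gcd' cb db] := gcd; have /and3P[ecd cu du] := gcd'.
  have cX : c \notin X by apply/negP => hc; rewrite (Nx _ _ hc ecd) eqxx in db.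
  have dX : d \notin X.
    apply/negP => hd; have := Nx d c hd; rewrite se => /(_ ecd) h.
    by rewrite h eqxx in cb.
  have cd : c != d by apply: contraTneq ecd => ->; rewrite ie.
  have sub j : j \in c |: (d |: X) -> g b j.
    by rewrite !in_setU1 => /or3P[/eqP->|/eqP->|/Xg//]; rewrite gE.
  have := deg_ge_card sub; rewrite !cardsU1 in_setU1 negb_or cd cX dX /= !add1n.
  have := nedges_avoid c ig1 sg1; have := deg_gt0 gcd; move: e1.
  move: (deg _ _) (deg _ _) (nedges _) (nedges _) #|_|; clear; lia.
(* Nesting forces [d] to be joined to [b]; then [b] and [d] jointly see everything. The edge count
   gives [deg e u <= 3], and [deg e b <= deg e u] gives [#|X| <= 1], hence [n <= 5]. *)
have one c d : g1 c d -> ~~ e b c -> False.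
  move=> gcd ebc.
  have /and3P[gcd' cb db] := gcd; have /and3P[ecd cu du] := gcd'.
  have euc : e u c.
    apply/negPn/negP => euc; have cX : c \in X by rewrite inE cu euc.
    by have h := Nx _ _ cX ecd; rewrite h eqxx in db.
  have eud : e u d.
    apply/negPn/negP => eud; have dX : d \in X by rewrite inE du eud.
    by rewrite se in ecd; have h := Nx _ _ dX ecd; rewrite h eqxx in cb.
  have dX : d \notin X by apply/negP => /XP[_]; rewrite eud.
  have nx0 z : z != b -> ~~ e z x0.
    by move=> zb; apply: contraNN zb; rewrite se => /(Nx _ _ x0X) ->.
  have ebd : e b d.
    apply/negPn/negP => ebd; have bc : b != c by rewrite eq_sym.
    by apply: (clo_a b c u x0 d); rewrite // ?nx0 // se.
  have cov : forall z, [|| z == b, z == d, e b z | e d z].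
    by apply: (clo_b b d x0 c); rewrite // ?nx0 ?(Xnb _ _ x0X eud) // se.
  have sub j : j \in d |: X -> g b j.
    by rewrite !in_setU1 => /orP[/eqP->|/Xg//]; rewrite gE.
  have := deg_ge_card sub; rewrite cardsU1 dX add1n.
  have sub' j : j \in u |: (d |: X) -> e b j.
    by rewrite !in_setU1 => /or3P[/eqP->|/eqP-> //|/ebX//]; rewrite se.
  have := deg_ge_card sub'; rewrite !cardsU1 in_setU1 negb_or dX eq_sym du.
  rewrite (_ : u \notin X) /= ?add1n; last by rewrite inE eqxx.
  have c2 : (n <= 2 + deg g b + deg g1 d)%N.
    apply: (@cover_card _ [:: u; b]) => z.
    rewrite !inE !negb_or => /andP[zu zb].
    rewrite gE // /g1 /avoid gE // db zb !andbT.
    have := cov z; rewrite (negPf zb) /=; case/or3P => [/eqP ->||].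
    - by rewrite ebd.
    - by move=> ->.
    - by move=> ->; rewrite orbT.
  have := nedges_avoid d ig1 sg1; have := umax b; move: e1 c2 nX n6.
  move: (deg e b) (deg e u) (deg g b) (deg g1 d) (nedges _) (nedges _) #|_|; clear; lia.
have g1_0 c d : g1 c d = false.
  apply/negP => gcd; have /nandP[h|h] := two c d gcd; first exact: one gcd h.
  by apply: (one d c) => //; rewrite sg1.
have ng1 : nedges g1 = 0%N.
  by apply: eq_card0 => -[c d]; rewrite !inE /= g1_0.
rewrite ng1 addn0 in e1.
(* All edges off [u] now end in [b]: they lead to the [#|X|] leaves in [X] and to two further
   vertices, which [u] also sees. *)
have [m1|m2] := eqVneq #|X| 1%N.
  left; have XE : X = [set x0].
    by apply/esym/eqP; rewrite eqEcard finset.sub1set x0X m1 cards1.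
  have : #|[set y | g b y] :\ x0| == 2%N.
    have := cardsD1 x0 [set y | g b y].
    by rewrite inE Xg // -[X in X = _]/(deg g b) -e1 m1 add1n => -[<-].
  move=> /cards2P [s [t [st stE]]].
  have gb j : g b j = [|| j == s, j == t | j == x0].
    have := in_set2 j s t; rewrite -stE !inE.
    have [->|jx] := eqVneq j x0; first by rewrite Xg // !orbT.
    by rewrite /= => ->; rewrite orbF.
  have gs : g b s by rewrite gb eqxx.
  have gt : g b t by rewrite gb eqxx orbT.
  have [sx tx] : s != x0 /\ t != x0.
    have := in_set2 s s t; have := in_set2 t s t.
    by rewrite -stE !inE !eqxx orbT => /andP[-> _] /andP[-> _].
  have /and3P[ebs _ su] := gs; have /and3P[ebt _ tu] := gt.
  have euE x : e u x = (x != u) && (x != x0).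
    have : (x \in X) = (x == x0) by rewrite XE inE.
    by rewrite inE; have [->|xu] := eqVneq x u; rewrite ?ie //= => <-; rewrite negbK.
  apply: (@iso_B3 _ _ u b s t x0) => //.
    have bs : b != s by apply: contraTneq gs => <-; rewrite ig.
    have bt : b != t by apply: contraTneq gt => <-; rewrite ig.
    rewrite /= !inE !negb_or !(eq_sym u) bu su tu (Xu _ x0X) bs bt st sx tx.
    by rewrite (eq_sym b) (Xnb _ _ x0X eub).
  by move=> x y; rewrite -/g (adj_avoid b) // -/g1 g1_0 orbF !gb.
(* With two or more vertices outside, the private neighbours of [u] and of [b] are leaves, at least
   [#|X|] on either side, so a partial shift improves the graph. *)
case: nimp.
have exE : excl e b u = X.
  apply/finset.setP => j; rewrite !inE; have [->|ju] := eqVneq j u; first by rewrite !andbF.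
  rewrite andbT; apply/andP/idP => [[_ ->]//|euj]; split => //.
  by apply: ebX; rewrite inE ju.
apply: (broom_improvable p1 be nu (u := u) (v := b)) => //.
- by rewrite eq_sym.
- have := deg_excl_le u b ie se; have := umax b; rewrite exE.
  move: m0 m2; move: (deg _ _) (deg _ _) #|X| #|_|; clear; lia.
- by rewrite exE; move: m0 m2; move: #|_|; clear; lia.
- move=> j; rewrite inE => /and3P[euj ebj jb].
  rewrite -(cards1 u); apply: eq_card => y; rewrite !inE.
  rewrite (adj_avoid u) // -/g (adj_avoid b (e := g)) // -/g1 g1_0 (negPf (nbu _ euj)).
  rewrite (negPf jb) /= orbF euj andbT [g b j]gE ?(nbu _ euj) //.
  by rewrite (negPf ebj) andbF orbF.
- move=> j; rewrite exE => jX; rewrite -(cards1 b); apply: eq_card => y.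
  rewrite !inE; apply/idP/eqP => [/(Nx _ _ jX)//|->]; rewrite se.
  exact: ebX.
Qed.

(** * Rows of the labelled graphs

    From here on graphs have [n.+4.+1] vertices: five labelled ones, and [n] more
    which all behave like vertex 5. *)

Lemma sum_ord5 (V : nmodType) n (F : nat -> V) :
  (forall j, F j.+4.+1 = F 5%N) ->
  \sum_(i < n.+4.+1) F i = F 0%N + F 1%N + F 2%N + F 3%N + F 4%N + F 5%N *+ n.
Proof.
move=> hF; rewrite 5!big_ord_recl !addrA; congr (_ + _).
rewrite (eq_bigr (fun=> F 5%N)) => [|i _]; last exact: (hF i).
by rewrite sumr_const card_ord.
Qed.

Definition adjs (adj : nat -> nat -> bool) i j := adj i j || adj j i.

Lemma deg_row n (e : rel 'I_n.+4.+1) (adj : nat -> nat -> bool) (x : 'I_n.+4.+1) :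
  (forall x y, e x y = adjs adj x y) ->
  (forall j, adjs adj x j.+4.+1 = adjs adj x 5) ->
  deg e x = (adjs adj x 0 + adjs adj x 1 + adjs adj x 2 + adjs adj x 3 +
             adjs adj x 4 + adjs adj x 5 * n)%N.
Proof.
move=> eE h; transitivity (\sum_(y < n.+4.+1) (adjs adj x y : nat))%N.
  rewrite /deg -sum1_card big_mkcond /=; apply: eq_bigr => y _.
  by rewrite inE eE; case: adjs.
rewrite (@sum_ord5 nat n (fun j => adjs adj x j : nat)) => [|j]; last by rewrite h.
congr (_ + _)%N; case: (adjs adj x 5); last by rewrite mul0rn.
by rewrite mul1n; exact: natn.
Qed.

Definition wt (R : realType) (p : R) (a b : nat) : R := pnorm p a%:R b%:R.

Definition entry (R : realType) (p : R) (adj : nat -> nat -> bool)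
  (d : nat -> nat) (z : nat -> R) i j : R :=
  if adjs adj i j then wt p (d i) (d j) * z j else 0.

Lemma psombor_row (R : realType) n (p : R) (e : rel 'I_n.+4.+1)
    (adj : nat -> nat -> bool) (d : nat -> nat) (z : nat -> R) (x : 'I_n.+4.+1) :
  (forall x y, e x y = adjs adj x y) -> (forall x, deg e x = d x) ->
  (forall j, adjs adj x j.+4.+1 = adjs adj x 5) ->
  (forall j, d j.+4.+1 = d 5%N) -> (forall j, z j.+4.+1 = z 5%N) ->
  \sum_j psombor_mx p e x j * z j =
  entry p adj d z x 0 + entry p adj d z x 1 + entry p adj d z x 2 +
  entry p adj d z x 3 + entry p adj d z x 4 + entry p adj d z x 5 * n%:R.
Proof.
move=> eE dE ha hd hz; rewrite mulr_natr.
rewrite -(@sum_ord5 _ n (entry p adj d z x)); last first.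
  by move=> j; rewrite /entry ha hd hz.
apply: eq_bigr => j _; rewrite psomborE eE !dE /entry /wt.
by case: adjs; rewrite ?mul0r.
Qed.

Lemma B3_E n x y : B3 n x y = adjs B3adj x y.
Proof. exact: sym_ofE B3_lt. Qed.

Lemma B2_E n x y : B2 n x y = adjs B2adj x y.
Proof. exact: sym_ofE B2_lt. Qed.

Lemma kite_E n x y : kite n x y = adjs kite_adj x y.
Proof. exact: sym_ofE kite_lt. Qed.

Definition degB3 n (i : nat) : nat :=
  match i with 0 => n.+3 | 1 => 4 | 2 => 2 | 3 => 2 | _ => 1 end.
Definition degB2 n (i : nat) : nat :=
  match i with 0 => n.+4 | 1 => 2 | 2 => 2 | 3 => 2 | 4 => 2 | _ => 1 end.
Definition degkite n (i : nat) : nat :=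
  match i with 0 => n.+3 | 1 => 3 | 2 => 3 | 3 => 2 | _ => 1 end.

Lemma deg_B3 n x : deg (B3 n.+4.+1) x = degB3 n x.
Proof.
rewrite (deg_row (@B3_E _)); case: x => i /= _; do 5?[case: i => [|i]] => //=.
by rewrite mul1n.
Qed.

Lemma deg_B2 n x : deg (B2 n.+4.+1) x = degB2 n x.
Proof.
rewrite (deg_row (@B2_E _)); case: x => i /= _; do 5?[case: i => [|i]] => //=.
by rewrite mul1n.
Qed.

Lemma deg_kite n x : deg (kite n.+4.+1) x = degkite n x.
Proof.
rewrite (deg_row (@kite_E _)); case: x => i /= _; do 5?[case: i => [|i]] => //=.
by rewrite mul1n.
Qed.

Definition row_B3 (R : realType) (p : R) n (z : nat -> R) (i : nat) : R :=
  match i with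
  | 0 => wt p n.+3 4 * z 1%N + wt p n.+3 2 * z 2%N + wt p n.+3 2 * z 3%N +
         wt p n.+3 1 * z 5%N * n%:R
  | 1 => wt p 4 n.+3 * z 0%N + wt p 4 2 * z 2%N + wt p 4 2 * z 3%N + wt p 4 1 * z 4%N
  | 2 => wt p 2 n.+3 * z 0%N + wt p 2 4 * z 1%N
  | 3 => wt p 2 n.+3 * z 0%N + wt p 2 4 * z 1%N
  | 4 => wt p 1 4 * z 1%N
  | _ => wt p 1 n.+3 * z 0%N
  end.

Lemma B3_row (R : realType) (p : R) n (z : nat -> R) (x : 'I_n.+4.+1) :
  (forall j, z j.+4.+1 = z 5%N) ->
  \sum_j psombor_mx p (B3 n.+4.+1) x j * z j = row_B3 p n z x.
Proof.
move=> hz; have ha j : adjs B3adj x j.+4.+1 = adjs B3adj x 5.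
  by case: x => i /= _; do 5?[case: i => [|i]].
rewrite (psombor_row p (@B3_E _) (@deg_B3 n) ha _ hz) //.
case: x {ha} => i /= _; do 5?[case: i => [|i]]; rewrite /entry /= ?mul0r ?addr0 ?add0r //.
Qed.

Definition row_B2 (R : realType) (p : R) n (z : nat -> R) (i : nat) : R :=
  match i with
  | 0 => wt p n.+4 2 * z 1%N + wt p n.+4 2 * z 2%N + wt p n.+4 2 * z 3%N +
         wt p n.+4 2 * z 4%N + wt p n.+4 1 * z 5%N * n%:R
  | 1 => wt p 2 n.+4 * z 0%N + wt p 2 2 * z 2%N
  | 2 => wt p 2 n.+4 * z 0%N + wt p 2 2 * z 1%N
  | 3 => wt p 2 n.+4 * z 0%N + wt p 2 2 * z 4%N
  | 4 => wt p 2 n.+4 * z 0%N + wt p 2 2 * z 3%N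
  | _ => wt p 1 n.+4 * z 0%N
  end.

Lemma B2_row (R : realType) (p : R) n (z : nat -> R) (x : 'I_n.+4.+1) :
  (forall j, z j.+4.+1 = z 5%N) ->
  \sum_j psombor_mx p (B2 n.+4.+1) x j * z j = row_B2 p n z x.
Proof.
move=> hz; have ha j : adjs B2adj x j.+4.+1 = adjs B2adj x 5.
  by case: x => i /= _; do 5?[case: i => [|i]].
rewrite (psombor_row p (@B2_E _) (@deg_B2 n) ha _ hz) //.
case: x {ha} => i /= _; do 5?[case: i => [|i]]; rewrite /entry /= ?mul0r ?addr0 ?add0r //.
Qed.

Definition row_kite (R : realType) (p : R) n (z : nat -> R) (i : nat) : R :=
  match i with
  | 0 => wt p n.+3 3 * z 1%N + wt p n.+3 3 * z 2%N + wt p n.+3 1 * z 4%N +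
         wt p n.+3 1 * z 5%N * n%:R
  | 1 => wt p 3 n.+3 * z 0%N + wt p 3 3 * z 2%N + wt p 3 2 * z 3%N
  | 2 => wt p 3 n.+3 * z 0%N + wt p 3 3 * z 1%N + wt p 3 2 * z 3%N
  | 3 => wt p 2 3 * z 1%N + wt p 2 3 * z 2%N
  | _ => wt p 1 n.+3 * z 0%N
  end.

Lemma kite_row (R : realType) (p : R) n (z : nat -> R) (x : 'I_n.+4.+1) :
  (forall j, z j.+4.+1 = z 5%N) ->
  \sum_j psombor_mx p (kite n.+4.+1) x j * z j = row_kite p n z x.
Proof.
move=> hz; have ha j : adjs kite_adj x j.+4.+1 = adjs kite_adj x 5.
  by case: x => i /= _; do 5?[case: i => [|i]].
rewrite (psombor_row p (@kite_E _) (@deg_kite n) ha _ hz) //.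
case: x {ha} => i /= _; do 5?[case: i => [|i]]; rewrite /entry /= ?mul0r ?addr0 ?add0r //.
Qed.

(** * Connectedness of the labelled graphs; B2 versus B1 *)

Lemma connected_down n (e : rel 'I_n) : symmetric e ->
  (forall x : 'I_n, (0 < x)%N -> exists2 y : 'I_n, (y < x)%N & e x y) ->
  connected_graph e.
Proof.
move=> se h; have cs : connect_sym e by exact: sym_connect_sym.
have low k (x : 'I_n) : (x <= k)%N -> exists2 y : 'I_n, y = 0%N :> nat & connect e x y.
  elim: k x => [|k IH] x xk; first by exists x; [move: xk; rewrite leqn0 => /eqP|].
  have [x0|x0] := posnP x; first by exists x.
  have [y yx exy] := h x x0; have [|z z0 cz] := IH y.
    by rewrite -ltnS (leq_trans yx).
  by exists z => //; apply: connect_trans (connect1 exy) cz.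
move=> x y; have [a a0 ca] := low x x (leqnn _); have [b b0 cb] := low y y (leqnn _).
have ab : a = b by apply: val_inj; rewrite /= a0 b0.
by apply: connect_trans ca _; rewrite cs ab.
Qed.

Lemma sym_of_sym n adj : symmetric (@sym_of n adj).
Proof. by move=> x y; rewrite /sym_of; case: ltngtP. Qed.

Lemma sym_of_irr n adj : irreflexive (@sym_of n adj).
Proof. by move=> x; rewrite /sym_of ltnn. Qed.

Lemma B2_bicyclic n : bicyclic (B2 n.+4.+1).
Proof.
have se : symmetric (B2 n.+4.+1) := @sym_of_sym _ _.
have ie : irreflexive (B2 n.+4.+1) := @sym_of_irr _ _.
split=> //.
  apply: connected_down => // x x0; exists ord0 => //.
  by rewrite B2_E /adjs /B2adj /= x0 orbT.
have := handshake ie se.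
under eq_bigr do rewrite deg_B2.
rewrite (@sum_ord5 nat n (degB2 n)) //= natn.
move: (nedges _); clear; lia.
Qed.

Lemma kite_connected n : connected_graph (kite n.+4.+1).
Proof.
apply: connected_down => [|x x0]; first exact: sym_of_sym.
have [x3|x3] := eqVneq (x : nat) 3; last first.
  by exists ord0 => //; rewrite kite_E /adjs /kite_adj /= x0 x3 orbT.
have h1 : (1 < n.+4.+1)%N by [].
by exists (Ordinal h1); rewrite ?x3 // kite_E /adjs x3.
Qed.

(** Vertices 1 and 3 lie in different triangles and share the neighbour 0, which stays universal
    under the shift. The result is B1 or B2 by [universal_iso], and the strict increase rules out
    B2. *)
Lemma rho_B2_lt_B1 (R : realType) (p : R) n : 1 <= p ->
  rho (psombor_mx p (B2 n.+4.+1)) < rho (psombor_mx p (B1 n.+4.+1)).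
Proof.
move=> p1; have be := B2_bicyclic n; have [[ie se] _ _] := be.
have [h1 h2 h3 h4] : [/\ 1 < n.+4.+1, 2 < n.+4.+1, 3 < n.+4.+1 & 4 < n.+4.+1]%N by [].
pose u := Ordinal h1; pose v := Ordinal h3.
have uv : u != v by [].
have e13 : (0 < #|excl (B2 n.+4.+1) u v|)%N.
  by apply/card_gt0P; exists (Ordinal h2); rewrite inE !B2_E.
have e31 : (0 < #|excl (B2 n.+4.+1) v u|)%N.
  by apply/card_gt0P; exists (Ordinal h4); rewrite inE !B2_E.
have main (a b : 'I_n.+4.+1) : (0 < a)%N -> (0 < b)%N -> a != b ->
    rho (psombor_mx p (B2 n.+4.+1)) <
      rho (psombor_mx p (shift (B2 n.+4.+1) a b (excl (B2 n.+4.+1) b a))) ->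
    rho (psombor_mx p (B2 n.+4.+1)) < rho (psombor_mx p (B1 n.+4.+1)).
  move=> a0 b0 ab h.
  have e0 (z : 'I_n.+4.+1) : (0 < z)%N -> B2 n.+4.+1 ord0 z.
    by move=> z0; rewrite B2_E /adjs /B2adj z0.
  have be' : bicyclic (shift (B2 n.+4.+1) a b (excl (B2 n.+4.+1) b a)).
    apply: shift_bicyclic => //; right; exists ord0; rewrite se; exact: e0.
  have [z z0|iso|iso] := @universal_iso _ _ ord0 be'.
  - have z1 : (0 < z)%N by rewrite lt0n.
    have ne0 (k : 'I_n.+4.+1) : (0 < k)%N -> ord0 != k.
      by rewrite lt0n => k0; rewrite eq_sym; exact: k0.
    rewrite shiftE_other ?e0 ?ne0 // inE (se a ord0) (e0 a a0).
    by rewrite andbF.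
  - exact: (eq_ind _ (fun r => _ < r) h _ (rho_iso p iso)).
  - exfalso; have := eq_ind _ (fun r => _ < r) h _ (rho_iso p iso).
    by move: (rho _) => r; rewrite ltxx.
by have [h|h] := kelmans_rho_lt p1 be uv e13 e31; apply: main h.
Qed.

(** * Weights, and explicit bounds for the radii of B3 and B2 *)

Lemma wtC (R : realType) (p : R) a b : wt p a b = wt p b a.
Proof. exact: pnormC. Qed.

Lemma wt_gt0 (R : realType) (p : R) a b : (0 < a)%N -> 0 < wt p a b.
Proof. by move=> a0; apply: pnorm_gt0; rewrite ltr0n. Qed.

Lemma wt_le (R : realType) (p : R) a a' b b' : 1 <= p -> (a <= a')%N -> (b <= b')%N ->
  wt p a b <= wt p a' b'.
Proof. by move=> p1 aa bb; apply: pnorm_le; rewrite ?ler_nat ?ler0n //; lra. Qed.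

Lemma wt_lt (R : realType) (p : R) a a' b : 1 <= p -> (a < a')%N ->
  wt p a b < wt p a' b.
Proof. by move=> p1 aa; apply: pnorm_lt; rewrite ?ltr_nat ?ler0n //; lra. Qed.

Lemma wt_increments (R : realType) (p : R) c d k j : 1 <= p -> (0 < j)%N -> (c <= d)%N ->
  wt p d j + wt p (c + k) j <= wt p c j + wt p (d + k) j.
Proof.
move=> p1 j0 cd; rewrite /wt !natrD.
by apply: pnorm_increments; rewrite ?ler_nat ?ler0n ?ltr0n.
Qed.

Lemma wt_spread (R : realType) (p : R) a c k : 1 <= p -> (c <= a)%N ->
  wt p a (c + k) <= wt p (a + k) c.
Proof.
move=> p1 ca; rewrite /wt !natrD.
by apply: pnorm_spread; rewrite ?ler_nat ?ler0n.
Qed.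

Lemma wt_ge_max (R : realType) (p : R) a b : 1 <= p -> a%:R <= wt p a b.
Proof. by move=> p1; apply: pnorm_ge_max; rewrite ?ler0n //; lra. Qed.

Lemma wt_sqr_le (R : realType) (p : R) a b : 2 <= p -> (0 < a)%N ->
  wt p a b ^+ 2 <= a%:R ^+ 2 + b%:R ^+ 2.
Proof. by move=> p2 a0; apply: pnorm_sqr_le; rewrite ?ltr0n ?ler0n. Qed.

Lemma quad_rows (R : realType) n (A : 'M[R]_n) (y : 'I_n -> R) :
  \sum_i \sum_j A i j * y i * y j = \sum_i y i * \sum_j A i j * y j.
Proof.
apply: eq_bigr => i _; rewrite mulr_sumr; apply: eq_bigr => j _.
by rewrite mulrA [y i * _]mulrC.
Qed.

(** The entries at the vertices of degree 1 and 2 make their rows equalities at [c]. Once they are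
    eliminated, the rows of vertices 1 and 0, multiplied by [c], are the two hypotheses. *)
Lemma rho_B3_le (R : realType) (p : R) n (c v : R) : 1 <= p -> 0 < c -> 0 < v ->
  wt p n.+3 4 * c + 2 * wt p 4 2 * wt p n.+3 2 +
    (2 * wt p 4 2 ^+ 2 + wt p 4 1 ^+ 2) * v <= c ^+ 2 * v ->
  v * (wt p n.+3 4 * c + 2 * wt p 4 2 * wt p n.+3 2) +
    2 * wt p n.+3 2 ^+ 2 + n%:R * wt p n.+3 1 ^+ 2 <= c ^+ 2 ->
  rho (psombor_mx p (B3 n.+4.+1)) <= c.
Proof.
move=> p1 c0 v0 H1 H0.
pose z k := match k with 0 => 1 | 1 => v
  | 2 | 3 => (wt p n.+3 2 + wt p 4 2 * v) / c | 4 => wt p 4 1 * v / c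
  | _ => wt p n.+3 1 / c end.
have hz j : z j.+4.+1 = z 5%N by [].
have se : symmetric (B3 n.+4.+1) := @sym_of_sym _ _.
have w_gt0 a b : 0 < wt p a.+1 b by apply: wt_gt0.
apply: (@rho_le_super _ _ _ (fun i => z i)) => //.
- exact: psombor_tr.
- exact: psombor_ge0.
- case=> i /= _; have s0 : 0 < (wt p n.+3 2 + wt p 4 2 * v) / c.
    by rewrite divr_gt0 // addr_gt0 // mulr_gt0.
  do 5?[case: i => [|i]] => //=; rewrite divr_gt0 // mulr_gt0 //.
move=> x; rewrite B3_row //; have cn : c != 0 by rewrite gt_eqF.
have cd r : c * (r / c) = r by rewrite mulrC divfK.
have tight a b : a * 1 + b * v <= c * ((a + b * v) / c) by rewrite cd mulr1.
have tight1 a : a * 1 <= c * (a / c) by rewrite cd mulr1.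
case: x => i /= _; rewrite /z.
do 5?[case: i => [|i]] => /=; rewrite ?(wtC p 1) ?(wtC p 2 n.+3) ?(wtC p 2 4) ?(wtC p 4 n.+3).
- rewrite -(ler_pM2r c0) mulr1 -expr2; apply: le_trans H0.
  move: (wt p _ _) (wt p _ _) (wt p _ _) (wt p _ _) (n%:R) => *.
  rewrite le_eqVlt; apply/orP; left; apply/eqP; field.
  exact: cn.
- rewrite -(ler_pM2r c0) [leRHS]mulrAC -expr2; apply: le_trans H1.
  move: (wt p _ _) (wt p _ _) (wt p _ _) (wt p _ _) => *.
  rewrite le_eqVlt; apply/orP; left; apply/eqP; field.
  exact: cn.
- exact: tight.
- exact: tight.
- by rewrite cd.
- exact: tight1.
Qed.

(** The test vector satisfies every row but that of the centre exactly at [c]; the hypothesis is the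
    strict inequality in the central row, cleared of the denominators [c] and [c - wt p 2 2]. *)
Lemma rho_B2_gt (R : realType) (p : R) n (c : R) : 1 <= p -> wt p 2 2 < c ->
  c ^+ 2 * (c - wt p 2 2) <
  4 * wt p n.+4 2 ^+ 2 * c + n%:R * wt p n.+4 1 ^+ 2 * (c - wt p 2 2) ->
  c < rho (psombor_mx p (B2 n.+4.+1)).
Proof.
move=> p1 cw H.
have se : symmetric (B2 n.+4.+1) := @sym_of_sym _ _.
have w0 : 0 < wt p 2 2 by apply: wt_gt0.
have c0 : 0 < c := lt_trans w0 cw.
have d0 : 0 < c - wt p 2 2 by rewrite subr_gt0.
have cn : c != 0 by rewrite gt_eqF.
have dn : c - wt p 2 2 != 0 by rewrite gt_eqF.
pose z k := match k with 0 => 1 | 1 | 2 | 3 | 4 => wt p n.+4 2 / (c - wt p 2 2)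
  | _ => wt p n.+4 1 / c end.
have hz j : z j.+4.+1 = z 5%N by [].
have step a : a * 1 + wt p 2 2 * (a / (c - wt p 2 2)) = c * (a / (c - wt p 2 2)).
  by move: (wt p 2 2) dn => w dn; field.
have r0 : c < row_B2 p n z 0.
  rewrite /row_B2 /z -(ltr_pM2r c0) -(ltr_pM2r d0) -expr2; apply: lt_le_trans H _.
  move: (wt p _ _) (wt p _ _) (wt p _ _) (n%:R) dn => a b d N dn.
  rewrite le_eqVlt; apply/orP; left; apply/eqP; field.
  by rewrite cn dn.
have ri i : row_B2 p n z i.+1 = c * z i.+1.
  rewrite /row_B2 /z; do 4?[case: i => [|i]] => /=; rewrite (wtC p _ n.+4).
  1-4: exact: step.
  by have cd a : a * 1 = c * (a / c); [rewrite mulr1 mulrC divfK | exact: cd].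
have := rho_rayleigh (fun i => z i) (psombor_tr p se) (ltn0Sn n.+4).
rewrite quad_rows.
under eq_bigr do rewrite B2_row //.
have S0 : 0 < \sum_(i < n.+4.+1) z i ^+ 2.
  rewrite big_ord_recl ltr_pwDl ?exprn_gt0 //.
  by apply: sumr_ge0 => i _; rewrite sqr_ge0.
rewrite -(ltr_pM2r S0); apply: lt_le_trans.
rewrite mulr_sumr [ltLHS]big_ord_recl [ltRHS]big_ord_recl; apply: ltr_leD.
  by rewrite expr1n mulr1 mul1r.
rewrite le_eqVlt; apply/orP; left; apply/eqP; apply: eq_bigr => i _.
have -> : row_B2 p n z (lift ord0 i) = c * z (lift ord0 i) by exact: ri.
by move: (z _) => r; ring.
Qed.

(** * The kite versus B3 *)

Lemma kite_center_ge (R : realType) (D1 D3 w33 w32 U B X C m L : R) :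
  0 < D1 -> 0 < D3 -> 0 < w33 -> 0 < w32 -> 0 < U -> 0 < B -> 0 < L -> 1 <= m ->
  w33 <= D3 -> w32 <= D1 ->
  D3 * B + D3 * B + D1 * C + D1 * C * m = L * U ->
  D3 * U + w33 * B + w32 * X = L * B -> w32 * B + w32 * B = L * X ->
  D1 * U = L * C -> B <= U.
Proof.
move=> D10 D30 w330 w320 U0 B0 L0 m1 h33 h32 eU eB eX eC.
(* Eliminating [X] and [C] leaves two equations in [U] and [B]. If [U < B], then [w33 <= D3] and
   [2 * w32 ^+ 2 <= (1 + m) * D1 ^+ 2] make the product of [L ^+ 2 - 2 * w32 ^+ 2 + D3 * L] and
   [B - U] at most 0, although both factors are positive. *)
rewrite leNgt; apply/negP => UB.
have DU := mulr_gt0 D30 U0; have wB := mulr_gt0 w330 B0.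
have LB : L ^+ 2 * B = L * (D3 * U + w33 * B) + 2 * w32 ^+ 2 * B.
  have -> : L ^+ 2 * B = L * (L * B) by ring.
  rewrite -eB; have -> : L * (D3 * U + w33 * B + w32 * X) =
    L * (D3 * U + w33 * B) + w32 * (L * X) by ring.
  by rewrite -eX; ring.
have LU : L ^+ 2 * U = 2 * D3 * (L * B) + (1 + m) * D1 ^+ 2 * U.
  have -> : L ^+ 2 * U = L * (L * U) by ring.
  rewrite -eU; have -> : L * (D3 * B + D3 * B + D1 * C + D1 * C * m) =
    2 * D3 * (L * B) + (1 + m) * D1 * (L * C) by ring.
  by rewrite -eC; ring.
have L2 : 2 * w32 ^+ 2 < L ^+ 2.
  rewrite -(ltr_pM2r B0) LB ltrDr mulr_gt0 // addr_gt0 //.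
have h1 : 0 < (L ^+ 2 - 2 * w32 ^+ 2 + D3 * L) * (B - U).
  by rewrite mulr_gt0 ?subr_gt0 // ltr_pwDl ?subr_gt0 // ltW // mulr_gt0.
have h2 : 0 <= (D3 - w33) * (L * B) by rewrite mulr_ge0 ?subr_ge0 // ltW // mulr_gt0.
have h3 : w32 ^+ 2 <= D1 ^+ 2 by rewrite ler_sqr ?nnegrE // ltW.
have h4 : 0 <= (D1 ^+ 2 - w32 ^+ 2) * U by rewrite mulr_ge0 ?subr_ge0 // ltW.
have h5 : 0 <= (m - 1) * (D1 ^+ 2 * U).
  by rewrite mulr_ge0 ?subr_ge0 // mulr_ge0 ?sqr_ge0 // ltW.
nra.
Qed.

(** Both sides are half a quadratic form, without the [n] pendant terms that the two graphs share.
    The larger entry [C] is placed on vertex 3 of B3, [X] on its pendant vertex 4.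
    [2 * D3 <= D4 + D2] is convexity of the weight at the degrees 2, 3, 4. *)
Lemma kite_swap_le (R : realType) (D1 D2 D3 D4 w33 w32 w42 w41 U B X C : R) :
  0 < U -> 0 < B -> 0 < X -> 0 < C -> 2 * D3 <= D4 + D2 -> D1 < D2 ->
  w33 <= w42 -> w32 <= w42 -> w32 <= w41 -> 0 < w32 -> X <= C ->
  2 * D3 * U * B + D1 * U * C + w33 * B ^+ 2 + 2 * w32 * B * X <
  D4 * U * B + D2 * U * B + D2 * U * C + w42 * B ^+ 2 + w42 * B * C + w41 * B * X.
Proof.
move=> U0 B0 X0 C0 h1 h2 h3 h4 h5 w0 XC.
have a1 : 0 <= (D4 + D2 - 2 * D3) * (U * B) by rewrite mulr_ge0 ?subr_ge0 // mulr_ge0 // ltW.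
have a2 : 0 < (D2 - D1) * (U * C) by rewrite mulr_gt0 ?subr_gt0 // mulr_gt0.
have a3 : 0 <= (w42 - w33) * B ^+ 2 by rewrite mulr_ge0 ?subr_ge0 ?sqr_ge0.
have a4 : 0 <= (w42 - w32) * (B * X) by rewrite mulr_ge0 ?subr_ge0 // mulr_ge0 // ltW.
have a5 : 0 <= (w41 - w32) * (B * X) by rewrite mulr_ge0 ?subr_ge0 // mulr_ge0 // ltW.
have a6 : 0 <= w42 * (B * (C - X)).
  rewrite mulr_ge0 //; first by rewrite ltW // (lt_le_trans w0).
  by rewrite mulr_ge0 ?subr_ge0 // ltW.
lra.
Qed.

(** Here [X] and [C] keep their places. The pendant edge with entry [C] moves from [U] to [B] and
    [U] is joined to [X] instead, which pays off because [w41 * B <= D1 * U]. *)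
Lemma kite_swap_ge (R : realType) (D1 D2 D3 D4 w33 w32 w42 w41 U B X C : R) :
  0 < U -> 0 < B -> 0 < X -> 0 < C -> 2 * D3 <= D4 + D2 -> D1 < D2 ->
  w33 <= w42 -> w32 <= w42 -> w32 <= w41 -> 0 < w32 -> w41 <= D1 -> B <= U -> C <= X ->
  2 * D3 * U * B + D1 * U * C + w33 * B ^+ 2 + 2 * w32 * B * X <
  D4 * U * B + D2 * U * B + D2 * U * X + w42 * B ^+ 2 + w42 * B * X + w41 * B * C.
Proof.
move=> U0 B0 X0 C0 h1 h2 h3 h4 h5 w0 h6 BU CX.
have a1 : 0 <= (D4 + D2 - 2 * D3) * (U * B) by rewrite mulr_ge0 ?subr_ge0 // mulr_ge0 // ltW.
have a2 : 0 < (D2 - D1) * (U * X) by rewrite mulr_gt0 ?subr_gt0 // mulr_gt0.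
have a3 : 0 <= (w42 - w33) * B ^+ 2 by rewrite mulr_ge0 ?subr_ge0 ?sqr_ge0.
have a4 : 0 <= (w42 - w32) * (B * X) by rewrite mulr_ge0 ?subr_ge0 // mulr_ge0 // ltW.
have a5 : 0 <= (w41 - w32) * (B * X) by rewrite mulr_ge0 ?subr_ge0 // mulr_ge0 // ltW.
have w410 : 0 < w41 := lt_le_trans w0 h5.
have a6 : 0 <= (D1 * U - w41 * B) * (X - C).
  by rewrite mulr_ge0 ?subr_ge0 // ler_pM // ltW.
lra.
Qed.

(* Perron entries (U, B, B, X, C, ...) of the kite are used on B3 as
   (U, B, B, C, X, C, ...) or (U, B, B, X, C, C, ...), whichever order X and C have. *)
Lemma rho_kite_lt_B3 (R : realType) (p : R) n : 1 <= p -> (0 < n)%N ->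
  rho (psombor_mx p (kite n.+4.+1)) < rho (psombor_mx p (B3 n.+4.+1)).
Proof.
move=> p1 n0.
have se : symmetric (kite n.+4.+1) := @sym_of_sym _ _.
have se3 : symmetric (B3 n.+4.+1) := @sym_of_sym _ _.
have [x [x0 xA]] := psombor_perron p (ltn0Sn n.+4) se (@kite_connected n).
have [L LE] : exists L, L = rho (psombor_mx p (kite n.+4.+1)) by eexists.
rewrite -LE in xA.
(* A pendant row determines its entry from that of the centre, so all pendant entries coincide. *)
have tail (i : 'I_n.+4.+1) : (3 < i)%N -> wt p 1 n.+3 * x ord0 = L * x i.
  move=> i3; rewrite -xA (bigD1 ord0) //= big1 ?addr0.
    rewrite psomborE kite_E !deg_kite.
    have [-> ->] : adjs kite_adj i (ord0 : 'I_n.+4.+1) = true /\ degkite n i = 1%N.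
      by case: i i3 => i /= _; do 4?[case: i => [|i]].
    reflexivity.
  move=> j j0; rewrite psomborE kite_E.
  have j0' : (0 < j)%N by rewrite lt0n.
  have -> : adjs kite_adj i j = false; last by rewrite mul0r.
  case: i j {j0} i3 j0' => i hi [j hj] /= {hi hj}.
  by do 4?[case: i => [|i]]; do 4?[case: j => [|j]].
have w_gt0 a b : 0 < wt p a.+1 b by apply: wt_gt0.
have L0 : 0 < L.
  have := tail (inord 4); rewrite inordK // => /(_ isT) h.
  have : 0 < L * x (inord 4) by rewrite -h mulr_gt0.
  by rewrite pmulr_lgt0.
pose z k := match k with 0 => x (inord 0) | 1 => x (inord 1) | 2 => x (inord 2)
  | 3 => x (inord 3) | _ => x (inord 4) end.
have hz j : z j.+4.+1 = z 5%N by [].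
have zx (i : 'I_n.+4.+1) : x i = z i.
  have [i3|i3] := leqP i 3.
    have -> : x i = x (inord i) by rewrite inord_val.
    by case: i i3 => i /= _; do 4?[case: i => [|i]].
  have -> : z i = x (inord 4) by case: i i3 => i /= _; do 4?[case: i => [|i]].
  apply: (mulfI (_ : L != 0)); first by rewrite gt_eqF.
  by rewrite -!tail // inordK.
have row (i : 'I_n.+4.+1) : row_kite p n z i = L * z i.
  rewrite -kite_row // -zx -xA; apply: eq_bigr => j _; by rewrite zx.
have r k (h : (k < n.+4.+1)%N) : row_kite p n z k = L * z k := row (Ordinal h).
have e0 := r 0%N isT; have e1 := r 1%N isT; have e2 := r 2%N isT.
have e3 := r 3%N isT; have e4 := r 4%N isT.
have z0 k : 0 < z k by rewrite /z; do 4?[case: k => [|k]].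
have [U [B [B' [X [C [zU zB zB' zX [z4 z5]]]]]]] : exists U B B' X C,
  [/\ z 0%N = U, z 1%N = B, z 2%N = B', z 3%N = X & z 4%N = C /\ z 5%N = C].
  by do 5!eexists; split.
have U0 : 0 < U by rewrite -zU.
have B0 : 0 < B by rewrite -zB.
have X0 : 0 < X by rewrite -zX.
have C0 : 0 < C by rewrite -z4.
rewrite /row_kite zU zB zB' zX z4 ?z5 in e0 e1 e2 e3 e4.
have nrm : \sum_(i < n.+4.+1) x i ^+ 2 =
    U ^+ 2 + B ^+ 2 + B' ^+ 2 + X ^+ 2 + C ^+ 2 + C ^+ 2 * n%:R.
  under eq_bigr do rewrite zx.
  by rewrite (@sum_ord5 R n (fun k => z k ^+ 2)) // zU zB zB' zX z4 z5 mulr_natr.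
have quad : \sum_i \sum_j psombor_mx p (kite n.+4.+1) i j * x i * x j =
    U * row_kite p n z 0 + B * row_kite p n z 1 + B' * row_kite p n z 2 + X * row_kite p n z 3 +
    C * row_kite p n z 4 + C * row_kite p n z 5 * n%:R.
  rewrite quad_rows.
  transitivity (\sum_(i < n.+4.+1) z i * row_kite p n z i).
    apply: eq_bigr => i _; rewrite -kite_row // zx; congr (_ * _).
    by apply: eq_bigr => j _; rewrite zx.
  rewrite (@sum_ord5 R n (fun k => z k * row_kite p n z k)) //.
  by rewrite zU zB zB' zX z4 z5 mulr_natr.
have quad3 (y : nat -> R) : (forall j, y j.+4.+1 = y 5%N) ->
    \sum_(i < n.+4.+1) \sum_(j < n.+4.+1) psombor_mx p (B3 n.+4.+1) i j * y i * y j =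
    y 0%N * row_B3 p n y 0 + y 1%N * row_B3 p n y 1 + y 2%N * row_B3 p n y 2 +
    y 3%N * row_B3 p n y 3 + y 4%N * row_B3 p n y 4 + y 5%N * row_B3 p n y 5 * n%:R.
  move=> hy; rewrite (quad_rows _ (fun i => y i)).
  under eq_bigr do rewrite B3_row //.
  rewrite (@sum_ord5 R n (fun k => y k * row_B3 p n y k)) ?mulr_natr //.
  by move=> j; rewrite hy.
have c1 := @wt_increments R p 2 3 1 n.+3 p1 isT isT.
have c2 : wt p n.+3 1 < wt p n.+3 2 by rewrite ![wt p n.+3 _]wtC; exact: wt_lt.
have c3 : wt p 3 3 <= wt p 4 2 := @wt_spread R p 3 2 1 p1 isT.
have c4 : wt p 3 2 <= wt p 4 2 by exact: wt_le.
have c5 : wt p 3 2 <= wt p 4 1 := @wt_spread R p 3 1 1 p1 isT.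
have c6 : wt p 4 1 <= wt p n.+3 1 by exact: wt_le.
have c7 : wt p 3 3 <= wt p n.+3 3 by exact: wt_le.
have c8 : wt p 3 2 <= wt p n.+3 1 := le_trans c5 c6.
rewrite /row_kite zU zB zB' zX z4 z5 in quad.
have n1 : 1 <= n%:R :> R by rewrite ler1n.
have p330 := w_gt0 2 3; have p320 := w_gt0 2 2.
have pD1 := w_gt0 n.+2 1; have pD3 := w_gt0 n.+2 3.
rewrite !(wtC p _ n.+3) in c1 e0 e1 e2 e3 e4 quad.
rewrite (wtC p 2 3) in e3 quad.
have pick (y : nat -> R) : (forall j, y j.+4.+1 = y 5%N) ->
   y 0%N ^+ 2 + y 1%N ^+ 2 + y 2%N ^+ 2 + y 3%N ^+ 2 + y 4%N ^+ 2 + y 5%N ^+ 2 * n%:R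
   = \sum_(i < n.+4.+1) x i ^+ 2 ->
   \sum_i \sum_j psombor_mx p (kite n.+4.+1) i j * x i * x j <
   y 0%N * row_B3 p n y 0 + y 1%N * row_B3 p n y 1 + y 2%N * row_B3 p n y 2 +
    y 3%N * row_B3 p n y 3 + y 4%N * row_B3 p n y 4 + y 5%N * row_B3 p n y 5 * n%:R ->
   rho (psombor_mx p (kite n.+4.+1)) < rho (psombor_mx p (B3 n.+4.+1)).
  move=> hy hn hq; rewrite LE in xA.
  apply: (rho_lt_of_quad (y := fun i => y i) (ltn0Sn n.+4) se3 x0 xA).
    rewrite -hn (@sum_ord5 R n (fun k => y k ^+ 2)) ?mulr_natr // => j.
    by rewrite hy.
  exact: (eq_ind_r (fun r => _ < r) hq (quad3 y hy)).
move: pick; rewrite quad nrm /row_B3.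
rewrite !(wtC p _ n.+3) (wtC p 2 4) (wtC p 1 4).
pose y1 k := match k with 0 => U | 1 => B | 2 => B | 3 => C | 4 => X | _ => C end.
pose y2 k := match k with 0 => U | 1 => B | 2 => B | 3 => X | _ => C end.
move=> pick.
have := pick y1 (fun j => erefl); have := pick y2 (fun j => erefl).
rewrite {pick} /y1 /y2 {y1 y2}.
move: p330 p320 pD1 pD3 n1 c1 c2 c3 c4 c5 c6 c7 c8 e0 e1 e2 e3 e4 U0 B0 X0 C0 L0.
clear.
move: (wt p n.+3 1) (wt p n.+3 2) (wt p n.+3 3) (wt p n.+3 4).
move: (wt p 3 3) (wt p 3 2) (wt p 4 2) (wt p 4 1) (n%:R : R).
move: (rho _ < rho _) => goal.
move=> w33 w32 w42 w41 m D1 D2 D3 D4.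
move=> p330 p320 pD1 pD3 n1 c1 c2 c3 c4 c5 c6 c7 c8 e0 e1 e2 e3 e4 U0 B0 X0 C0 L0.
(* The difference of the rows of the two twins [b] and [b'] is this equation, whose first factor is
   positive. *)
have EB : B' = B.
  have : (L + w33) * (B' - B) = 0 by lra.
  move/eqP; rewrite mulf_eq0 subr_eq0 gt_eqF ?addr_gt0 //= => /eqP //.
rewrite {}EB {B'} in e0 e1 e2 e3 *.
move=> h2 h1.
have [XC|/ltW CX] := leP X C.
  apply: h1; first by ring.
  have := @kite_swap_le R D1 D2 D3 D4 w33 w32 w42 w41 U B X C; lra.
apply: h2; first by ring.
have BU : B <= U by exact: (@kite_center_ge R D1 D3 w33 w32 U B X C m L).
have := @kite_swap_ge R D1 D2 D3 D4 w33 w32 w42 w41 U B X C; lra.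
Qed.

(** * B3 versus B2

    For at least seven vertices, [c^2 = (D + 1)^3 + 39 / 2] with [D] the maximal
    degree of B3 separates the radii. *)

(** The central row of B3 after the entry of vertex 1 has been eliminated and all weights replaced
    by their Euclidean bounds; the left side is the estimate of [B3_large_alg]. *)
Lemma large_poly (R : realType) (D c c2 : R) : 5 <= D ->
  c2 = (D + 1) ^+ 3 + 39 / 2 -> c ^+ 2 = c2 -> 0 <= c ->
  (D ^+ 2 + 16) * c2 + 18 * (D ^+ 2 + 10) * c + 80 * (D ^+ 2 + 4) <=
  (c2 - 57) * (c2 - 2 * (D ^+ 2 + 4) - (D - 3) * (D ^+ 2 + 1)).
Proof.
move=> D5 ec2 cc c0; have hc : c <= (c2 + 225) / 30.
  by have := sqr_ge0 (c - 15); nra.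
have hD : 0 <= 18 * (D ^+ 2 + 10).
  by rewrite mulr_ge0 ?addr_ge0 ?sqr_ge0 //; lra.
have hc' := ler_wpM2l hD hc.
have {hD hc cc c0} := hc'; move: (_ * c) => cr {c hc'}.
move=> hc; have [h [h0 Dh]] : exists h, 0 <= h /\ D = 5 + h by exists (D - 5); split; [lra | ring].
rewrite ec2 Dh in hc *.
have h2 : 0 <= h * h by rewrite mulr_ge0.
have h3 : 0 <= h * h * h by rewrite mulr_ge0.
have h4 : 0 <= h * h * h * h by rewrite mulr_ge0.
have h5 : 0 <= h * h * h * h * h by rewrite mulr_ge0.
have h6 : 0 <= h * h * h * h * h * h by rewrite mulr_ge0.
lra.
Qed.

(** Origin of [39 / 2]: with [N = D + 1] as lower bound for the central weights, the central row of
    B2 exceeds [N ^+ 3] by [4 * N ^+ 2 * w / (c - w)]. For [w >= 2] this is at least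
    [8 * N ^+ 2 / (c - 2)], more than [39 / 2] by the last hypothesis. *)
Lemma B2_large_alg (R : realType) (D a b w c : R) :
  6 <= D + 1 -> 0 < c -> 2 <= w -> w < c ->
  (D + 1) ^+ 2 <= a -> (D + 1) ^+ 2 <= b -> 39 * (c - 2) < 16 * (D + 1) ^+ 2 ->
  ((D + 1) ^+ 3 + 39 / 2) * (c - w) < 4 * a * c + (D - 3) * b * (c - w).
Proof.
have -> : D - 3 = (D + 1) - 4 by ring.
move: (D + 1) => N N6 c0 w2 wc aN bN cN.
have NN : 0 < N ^+ 2 by rewrite exprn_gt0 //; lra.
have h1 : 4 * N ^+ 2 * c <= 4 * a * c by rewrite ler_wpM2r ?(ltW c0) //; lra.
have cw : 0 < c - w by lra.
have h2 : (N - 4) * N ^+ 2 * (c - w) <= (N - 4) * b * (c - w).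
  by rewrite ler_wpM2r ?(ltW cw) // ler_wpM2l //; lra.
suff : (N ^+ 3 + 39 / 2) * (c - w) < 4 * N ^+ 2 * c + (N - 4) * N ^+ 2 * (c - w) by lra.
have h3 : 0 <= (w - 2) * (4 * N ^+ 2) by rewrite mulr_ge0 //; lra.
have -> : (N ^+ 3 + 39 / 2) * (c - w) =
  4 * N ^+ 2 * c + (N - 4) * N ^+ 2 * (c - w) +
  (39 / 2 * (c - w) - 4 * N ^+ 2 * w) by field.
lra.
Qed.

Lemma B3_large_alg (R : realType) (D a b s c : R) :
  0 < a -> 0 < b -> 0 < s -> 0 < c ->
  a ^+ 2 <= D ^+ 2 + 16 -> b ^+ 2 <= D ^+ 2 + 4 -> s ^+ 2 <= 20 ->
  (a * c + 2 * s * b) * (a * c + 2 * s * b) <=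
  (D ^+ 2 + 16) * c ^+ 2 + 18 * (D ^+ 2 + 10) * c + 80 * (D ^+ 2 + 4).
Proof.
move=> a0 b0 s0 c0 ha hb hs.
have s9 : s <= 9 / 2 by nra.
have ab : a * b <= D ^+ 2 + 10 by have := sqr_ge0 (a - b); nra.
have h1 : a ^+ 2 * c ^+ 2 <= (D ^+ 2 + 16) * c ^+ 2 by rewrite ler_wpM2r ?sqr_ge0.
have h2 : s * (a * b) <= 9 / 2 * (D ^+ 2 + 10).
  by rewrite ler_pM // ltW // mulr_gt0.
have h3 : s * (a * b) * c <= 9 / 2 * (D ^+ 2 + 10) * c by rewrite ler_wpM2r // ltW.
have h4 : s ^+ 2 * b ^+ 2 <= 20 * (D ^+ 2 + 4) by rewrite ler_pM ?sqr_ge0.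
have -> : (a * c + 2 * s * b) * (a * c + 2 * s * b) =
  a ^+ 2 * c ^+ 2 + 4 * (s * (a * b) * c) + 4 * (s ^+ 2 * b ^+ 2) by ring.
lra.
Qed.

Lemma rho_B3_lt_B2_large (R : realType) (p : R) n : 2 <= p -> (1 < n)%N ->
  rho (psombor_mx p (B3 n.+4.+1)) < rho (psombor_mx p (B2 n.+4.+1)).
Proof.
move=> p2 n2; have p1 : 1 <= p by lra.
have [D DE] : exists D : R, n.+3%:R = D by eexists.
have D5 : 5 <= D by rewrite -DE ler_nat.
have nE : n%:R = D - 3 by rewrite -DE -addn3 natrD addrK.
have NE : n.+4%:R = D + 1 by rewrite -DE natr1.
pose c2 := (D + 1) ^+ 3 + 39 / 2; pose c := Num.sqrt c2.
have N6 : 6 <= D + 1 by lra.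
have N3 : 216 <= (D + 1) ^+ 3.
  move: N6; move: (D + 1); clear => N N6.
  have h : 36 <= N ^+ 2 by nra.
  by rewrite exprS; nra.
have c20 : 0 < c2 by rewrite /c2; lra.
have c0 : 0 < c by rewrite sqrtr_gt0.
have cc : c ^+ 2 = c2 by rewrite sqr_sqrtr // ltW.
have w_gt0 a b : 0 < wt p a.+1 b by apply: wt_gt0.
have cN : 39 * (c - 2) < 16 * (D + 1) ^+ 2.
  have : c < 2 + 16 / 39 * (D + 1) ^+ 2.
    rewrite -ltr_sqr ?nnegrE ?(ltW c0) //; last by have := sqr_ge0 (D + 1); lra.
    rewrite cc /c2; move: N6; move: (D + 1); clear => N N6.
    have h2 : 36 <= N ^+ 2 by nra.
    have h3 : 0 <= (N - 6) * (N ^+ 2 * N) by rewrite !mulr_ge0 ?sqr_ge0 //; lra.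
    nra.
  lra.
have B2c : c < rho (psombor_mx p (B2 n.+4.+1)).
  have l2 : 2 <= wt p 2 2 := wt_ge_max 2 2 p1.
  have lN2 : D + 1 <= wt p n.+4 2 by rewrite -NE; exact: wt_ge_max.
  have lN1 : D + 1 <= wt p n.+4 1 by rewrite -NE; exact: wt_ge_max.
  have u2 : wt p 2 2 ^+ 2 <= 8.
    by apply: le_trans (@wt_sqr_le R p 2 2 p2 isT) _; rewrite -!natrX -natrD ler_nat.
  have wc : wt p 2 2 < c.
    rewrite -ltr_sqr ?nnegrE ?(ltW c0) ?(ltW (w_gt0 1%N 2%N)) //.
    by apply: le_lt_trans u2 _; rewrite cc /c2; move: N3; clear; lra.
  apply: (rho_B2_gt p1 wc); rewrite nE cc.
  have sq (x y : R) : 0 <= x -> x <= y -> x ^+ 2 <= y ^+ 2.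
    by move=> x0 xy; rewrite ler_sqr ?nnegrE // (le_trans x0).
  have N0 : 0 <= D + 1 by move: N6; clear; lra.
  have s2 := sq _ _ N0 lN2; have s1 := sq _ _ N0 lN1.
  exact: B2_large_alg.
apply: le_lt_trans B2c.
have W2 a b : wt p a.+1 b ^+ 2 <= a.+1%:R ^+ 2 + b%:R ^+ 2 by exact: wt_sqr_le.
have u4 : wt p n.+3 4 ^+ 2 <= D ^+ 2 + 16.
  by apply: le_trans (W2 _ _) _; rewrite DE -natrX.
have u2 : wt p n.+3 2 ^+ 2 <= D ^+ 2 + 4.
  by apply: le_trans (W2 _ _) _; rewrite DE -[2 ^+ 2]natrX.
have u1 : wt p n.+3 1 ^+ 2 <= D ^+ 2 + 1.
  by apply: le_trans (W2 _ _) _; rewrite DE expr1n.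
have u42 : wt p 4 2 ^+ 2 <= 20.
  by apply: le_trans (W2 _ _) _; rewrite -!natrX -natrD ler_nat.
have u41 : wt p 4 1 ^+ 2 <= 17.
  by apply: le_trans (W2 _ _) _; rewrite -!natrX -natrD ler_nat.
have p42 := w_gt0 3%N 2%N; have pD4 := w_gt0 n.+2 4%N; have pD2 := w_gt0 n.+2 2%N.
have key := @large_poly R D c c2 D5 erefl cc (ltW c0).
(* [57 = 2 * 20 + 17] bounds what the neighbours 2, 3, 4 return to vertex 1 of B3, so
   [K / (c2 - 57)] is an admissible entry there. *)
have d0 : 0 < c2 - 57 by rewrite /c2; move: N3; clear; lra.
pose K := wt p n.+3 4 * c + 2 * wt p 4 2 * wt p n.+3 2.
have t0 : 0 < 2 :> R by [].
have K0 : 0 < K := addr_gt0 (mulr_gt0 pD4 c0) (mulr_gt0 (mulr_gt0 t0 p42) pD2).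
apply: (rho_B3_le p1 c0 (divr_gt0 K0 d0)).
- rewrite -/K cc -lerBrDr -mulrBl.
  have {1}-> : K = (c2 - 57) * (K / (c2 - 57)) by rewrite mulrC divfK ?gt_eqF.
  apply: ler_wpM2r; first by rewrite ltW // divr_gt0.
  have fin (a b : R) : a <= 20 -> b <= 17 -> 2 * a + b <= 57 by clear; lra.
  by rewrite lerD2l lerN2; exact: fin.
rewrite -/K cc nE.
have h1 : K * K <= (c2 - 57) * (c2 - 2 * (D ^+ 2 + 4) - (D - 3) * (D ^+ 2 + 1)).
  apply: le_trans key; rewrite /K -cc.
  exact: B3_large_alg.
have h2 : K / (c2 - 57) * K <= c2 - 2 * (D ^+ 2 + 4) - (D - 3) * (D ^+ 2 + 1).
  by rewrite mulrAC ler_pdivrMr // [leRHS]mulrC.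
have h3 : (D - 3) * wt p n.+3 1 ^+ 2 <= (D - 3) * (D ^+ 2 + 1).
  apply: ler_wpM2l; [by move: D5; clear; lra | exact: u1].
have fin (x y z t E : R) : x <= E -> y <= t - 2 * E - z -> forall u, u <= z ->
    y + 2 * x + u <= t by clear => hx hy u hu; lra.
exact: fin u2 h2 _ h3.
Qed.

(* On six vertices the vertices 0 and 1 of B3 are twins, so its radius is the root
   [c] of [c^2 = w44 c + 4 w42^2 + w41^2]. The lemmas below compare it with B2; at
   [p = 2] the two radii differ by less than one percent. *)

Lemma bernoulli_lower (R : realType) (x q : R) : 0 <= x -> 0 <= q <= 1 ->
  1 + q * x * (1 - (1 - q) * x) <= (1 + x) `^ q.
Proof.
move=> x0 /andP[q0 q1]; have y0 : 0 < 1 + x by lra.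
have q'01 : 0 <= 1 - q <= 1 by lra.
have up := bernoulli_le1 y0 q'01.
have pos : 0 < (1 + x) `^ q := powR_gt0 _ y0.
(* The lower bound comes from the upper Bernoulli bound for the complementary exponent [1 - q]. *)
have split : (1 + x) `^ q * (1 + x) `^ (1 - q) = 1 + x.
  rewrite -powRD; last by apply/implyP => _; rewrite gt_eqF.
  have -> : q + (1 - q) = 1 by ring.
  by rewrite powRr1 // ltW.
have h : 1 + x <= (1 + x) `^ q * (1 + (1 - q) * x).
  rewrite -{1}split; apply: ler_wpM2l; first exact: ltW.
  by apply: le_trans up _; rewrite [1 + x]addrC addrK.
have d0 : 0 < 1 + (1 - q) * x by rewrite ltr_pwDl // mulr_ge0 //; lra.
rewrite -(ler_pM2r d0); apply: le_trans h.
have : 0 <= q * x * ((1 - q) * x) ^+ 2.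
  by apply: mulr_ge0; [exact: mulr_ge0 | exact: sqr_ge0].
lra.
Qed.

Lemma pnorm_sqr (R : realType) (p x y : R) : 0 < p -> 0 < x -> 0 <= y ->
  pnorm p x y ^+ 2 = x ^+ 2 * (1 + (y / x) `^ p) `^ (2 / p).
Proof.
move=> p0 x0 y0; have yx0 : 0 <= y / x by rewrite divr_ge0 // ltW.
have s0 : 0 <= 1 + (y / x) `^ p by rewrite addr_ge0 // powR_ge0.
have -> : pnorm p x y = x * (1 + (y / x) `^ p) `^ p^-1.
  rewrite /pnorm; have -> : x `^ p + y `^ p = x `^ p * (1 + (y / x) `^ p).
    by rewrite mulrDr mulr1 -powRM ?(ltW x0) // [x * _]mulrC divfK ?gt_eqF.
  by rewrite powRM ?powR_ge0 // -powRrM mulfV ?gt_eqF // powRr1 // ltW.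
rewrite exprMn -[X in _ * X = _]powR_mulrn ?powR_ge0 // -powRrM.
by rewrite [2 / p]mulrC.
Qed.

(** [4 / 5] is the quotient of [2 / 5] and [2 / 4], the degree ratios in [wt p 5 2] and [wt p 4 2];
    the bound ties their [p]-th powers together. *)
Lemma powR_four_fifths (R : realType) (t : R) : 0 <= t -> 1 - t / 4 <= (4 / 5) `^ t.
Proof.
move=> t0; rewrite /powR gt_eqF ?divr_gt0 //.
apply: le_trans (expR_ge1Dx _).
have h : ln (5 / 4 : R) <= 1 / 4.
  have -> : 5 / 4 = 1 + 1 / 4 :> R by field.
  by apply: le_ln1Dx; lra.
have e : ln (4 / 5 : R) = - ln (5 / 4).
  by rewrite -lnV ?posrE ?divr_gt0 // invf_div.
rewrite e lerD2l; have := ler_wpM2l t0 h; lra.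
Qed.

(** To be read with [q = 2 / p], [e = p - 2], [z] and [z'] the [p]-th powers of [2 / 4] and [2 / 5],
    and [T] the power [p - 2] of [4 / 5]. The expression bounds from below the excess over 27 in
    [wt_six_coefficient]; at [p = 2] it equals 1. *)
Lemma six_coefficient (R : realType) (q z z' T e : R) :
  0 < q -> q <= 1 -> 0 <= e -> q * e = 2 * (1 - q) ->
  0 <= z -> z <= 1 / 4 -> 0 <= z' -> z' <= 4 / 25 -> 25 * z' = 16 * z * T ->
  1 - e / 4 <= T ->
  0 <= 10 - 9 * q + 4 * q * (25 * z' - 16 * z) - 100 * q * (1 - q) * z' ^+ 2.
Proof.
move=> q0 q1 e0 qe z0 z4 z'0 z'25 zT Te.
have h1 : - (8 * (1 - q)) <= 4 * q * (25 * z' - 16 * z).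
  have a1 : 0 <= q * z * (T - (1 - e / 4)) by rewrite !mulr_ge0 ?subr_ge0 // ltW.
  have a2 : q * z * e = z * (2 * (1 - q)) by rewrite -qe; ring.
  have a3 : 0 <= (1 / 4 - z) * (1 - q) by rewrite mulr_ge0 ?subr_ge0.
  have -> : 4 * q * (25 * z' - 16 * z) = 64 * (q * z * (T - (1 - e / 4))) - 16 * (q * z * e).
    by rewrite zT; field.
  rewrite a2; lra.
have h2 : z' ^+ 2 <= 16 / 625.
  have -> : 16 / 625 = (4 / 25) ^+ 2 :> R by field.
  by rewrite ler_sqr ?nnegrE //; lra.
have h3 : q * (1 - q) * z' ^+ 2 <= q * (1 - q) * (16 / 625).
  by rewrite ler_wpM2l // mulr_ge0 ?subr_ge0 // ltW.
(* What remains is a positive quadratic in [q] with its minimum near [7 / 10]. *)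
have h4 := sqr_ge0 (q - 7 / 10).
lra.
Qed.

(** What is left of the B2 test once [c ^+ 2] is eliminated; [C] collects the coefficient of [c].
    Since [(c - w) ^+ 2 = w ^+ 2 + g], squaring the negated claim gives an inequality in [w ^+ 2]
    and [g] that fails on the stated ranges. *)
Lemma six_alg (R : realType) (w g b c C : R) :
  2 <= w -> w ^+ 2 <= 8 -> 80 <= g -> g <= 97 -> b <= 26 -> 0 < c -> w < c ->
  c ^+ 2 = 2 * w * c + g -> 27 <= C -> (g + b) * w < C * c.
Proof.
move=> w2 w8 g80 g97 b26 c0 wc cc C27.
suff h : (g + 26) * w < 27 * c.
  have h1 : (g + b) * w <= (g + 26) * w by rewrite ler_wpM2r //; lra.
  have h2 : 27 * c <= C * c by rewrite ler_wpM2r // ltW.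
  lra.
rewrite ltNge; apply/negP => h.
have d2 : (c - w) ^+ 2 = w ^+ 2 + g by rewrite sqrrB cc; ring.
have h1 : (27 * (c - w)) ^+ 2 <= ((g - 1) * w) ^+ 2.
  by rewrite ler_sqr ?nnegrE ?mulr_ge0 //; lra.
have h2 : 729 * (w ^+ 2 + g) <= (g - 1) ^+ 2 * w ^+ 2.
  by rewrite -d2; move: h1; rewrite !exprMn; have -> : 27 ^+ 2 = 729 :> R by ring.
have h3 : 0 <= ((g - 1) ^+ 2 - 729) * (8 - w ^+ 2).
  by rewrite mulr_ge0 ?subr_ge0 //; nra.
have h4 : 0 <= (g - 80) * (97 - g) by rewrite mulr_ge0 ?subr_ge0.
lra.
Qed.

Lemma six_assemble (R : realType) (q z z' y A B D W x1 x2 x3 x4 b : R) :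
  1 + q * z' * (1 - (1 - q) * z') <= A -> B <= 1 + q * z -> D <= 1 + q * y ->
  W <= 1 + q * 1 ->
  0 <= 10 - 9 * q + 4 * q * (25 * z' - 16 * z) - 100 * q * (1 - q) * z' ^+ 2 ->
  q * y <= q * (1 / 16) -> 5 ^+ 2 <= b ->
  x1 = 5 ^+ 2 * A -> x2 = 4 ^+ 2 * B -> x3 = 4 ^+ 2 * D -> x4 = 2 ^+ 2 * W ->
  27 <= 4 * x1 + b - 2 * x4 - (4 * x2 + x3).
Proof. by move=> l1 l2 l3 l4 key qy b25 -> -> -> ->; lra. Qed.

(** Each squared weight is the square of its larger degree times a power with exponent
    [q = 2 / p <= 1]. The leading [wt p 5 2] needs the second-order lower bound, the subtracted
    weights only the linear upper bound. At [p = 2] the right side is 29. *)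
Lemma wt_six_coefficient (R : realType) (p : R) : 2 <= p ->
  27 <= 4 * wt p 5 2 ^+ 2 + wt p 5 1 ^+ 2 - 2 * wt p 2 2 ^+ 2 -
        (4 * wt p 4 2 ^+ 2 + wt p 4 1 ^+ 2).
Proof.
move=> p2; have p0 : 0 < p by lra.
have [q qE] : exists q, q = 2 / p by eexists.
have q0 : 0 < q by rewrite qE divr_gt0.
have q1 : q <= 1 by rewrite qE ler_pdivrMr // mul1r.
have q01 : 0 <= q <= 1 by rewrite (ltW q0).
have small (x : R) : 0 < x -> x <= 1 -> x `^ p <= x ^+ 2.
  by move=> x0 x1; rewrite -powR_mulrn ?(ltW x0) // ger_powR // x0.
have sq (a b : nat) : (0 < a)%N -> wt p a b ^+ 2 =
    a%:R ^+ 2 * (1 + (b%:R / a%:R) `^ p) `^ q.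
  by move=> a0; rewrite qE; apply: pnorm_sqr; rewrite ?ltr0n.
have up (x : R) : 0 <= x -> (1 + x) `^ q <= 1 + q * x.
  move=> x0; have y0 : 0 < 1 + x by lra.
  by have := bernoulli_le1 y0 q01; rewrite [1 + x - 1]addrC addKr.
pose z : R := (2 / 4) `^ p; pose z' : R := (2 / 5) `^ p; pose y : R := (1 / 4) `^ p.
have z0 : 0 <= z := powR_ge0 _ _.
have z'0 : 0 <= z' := powR_ge0 _ _.
have y0 : 0 <= y := powR_ge0 _ _.
have z4 : z <= 1 / 4.
  have -> : 1 / 4 = (2 / 4) ^+ 2 :> R by field.
  by apply: small; lra.
have z'25 : z' <= 4 / 25.
  have -> : 4 / 25 = (2 / 5) ^+ 2 :> R by field.
  by apply: small; lra.
have y16 : y <= 1 / 16.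
  have -> : 1 / 16 = (1 / 4) ^+ 2 :> R by field.
  by apply: small; lra.
have e0 : 0 <= p - 2 by lra.
have T4 := powR_four_fifths e0.
have zT : 25 * z' = 16 * z * (4 / 5) `^ (p - 2).
  have -> : z' = z * (4 / 5) `^ p.
    rewrite /z /z' -powRM; [by congr (_ `^ _); field | lra | lra].
  have -> : (4 / 5) `^ p = (4 / 5) `^ (p - 2) * (4 / 5) ^+ 2 :> R.
    rewrite -powR_mulrn ?divr_ge0 // -powRD.
      by congr (_ `^ _); ring.
    by apply/implyP => _; rewrite gt_eqF // divr_gt0.
  have alg (u T : R) : 25 * (u * (T * (4 / 5) ^+ 2)) = 16 * u * T by field.
  exact: alg.
have qe : q * (p - 2) = 2 * (1 - q) by rewrite qE; field; rewrite gt_eqF.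
have key := six_coefficient q0 q1 e0 qe z0 z4 z'0 z'25 zT T4.
have b25 : 5 ^+ 2 <= wt p 5 1 ^+ 2.
  by rewrite ler_sqr ?nnegrE ?ler0n ?wt_ge_max // ?ltW ?wt_gt0 //; lra.
have a1 : wt p 5 2 ^+ 2 = 5 ^+ 2 * (1 + z') `^ q := sq 5 2 isT.
have a2 : wt p 4 2 ^+ 2 = 4 ^+ 2 * (1 + z) `^ q := sq 4 2 isT.
have a3 : wt p 4 1 ^+ 2 = 4 ^+ 2 * (1 + y) `^ q := sq 4 1 isT.
have a4 : wt p 2 2 ^+ 2 = 2 ^+ 2 * (1 + 1) `^ q.
  have h : 2 / 2 = 1 :> R by field.
  have e : (2 / 2 : R) `^ p = 1 by rewrite h powR1.
  exact: (eq_ind _ (fun r => _ = _ * (1 + r) `^ q) (sq 2 2 isT) _ e).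
have l1 := bernoulli_lower z'0 q01.
have l2 := up _ z0; have l3 := up _ y0; have l4 := up 1 ler01.
have qy : q * y <= q * (1 / 16) := ler_wpM2l (ltW q0) y16.
exact: (six_assemble l1 l2 l3 l4 key qy b25 a1 a2 a3 a4).
Qed.

(** Here [w], [x], [y], [a], [b] stand for the weights of degrees (2,2), (4,2), (4,1), (5,2), (5,1),
    and [2 * w] is the weight of (4,4). The last three conclusions are the hypotheses of [rho_B3_le]
    with [v = 1] and of [rho_B2_gt]. *)
Lemma six_witness (R : realType) (w x y a b : R) :
  2 <= w -> w ^+ 2 <= 8 -> 16 <= x ^+ 2 -> x ^+ 2 <= 20 -> 16 <= y ^+ 2 ->
  y ^+ 2 <= 17 -> b ^+ 2 <= 26 ->
  27 <= 4 * a ^+ 2 + b ^+ 2 - 2 * w ^+ 2 - (4 * x ^+ 2 + y ^+ 2) ->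
  exists c, [/\ 0 < c, w < c,
    2 * w * c + 2 * x * x + (2 * x ^+ 2 + y ^+ 2) * 1 <= c ^+ 2 * 1,
    1 * (2 * w * c + 2 * x * x) + 2 * x ^+ 2 + 1 * y ^+ 2 <= c ^+ 2 &
    c ^+ 2 * (c - w) < 4 * a ^+ 2 * c + 1 * b ^+ 2 * (c - w)].
Proof.
move=> l2 u22 x16 x20 y16 y17 b26 coef.
have [g gE] : exists g, g = 4 * x ^+ 2 + y ^+ 2 by eexists.
rewrite -gE in coef.
have g80 : 80 <= g by rewrite gE; lra.
have g97 : g <= 97 by rewrite gE; lra.
pose s := Num.sqrt (w ^+ 2 + g); pose c := w + s.
have wg0 : 0 < w ^+ 2 + g by have := sqr_ge0 w; lra.
have ss : s ^+ 2 = w ^+ 2 + g by rewrite sqr_sqrtr // ltW.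
have s0 : 0 < s by rewrite sqrtr_gt0.
have c0 : 0 < c by rewrite /c; lra.
have wc : w < c by rewrite /c; lra.
have cc : c ^+ 2 = 2 * w * c + g by rewrite /c sqrrD ss; ring.
exists c; split=> //; rewrite ?cc ?gE; try lra.
have := six_alg l2 u22 g80 g97 b26 c0 wc cc coef.
rewrite -gE; have -> : (2 * w * c + g) * (c - w) = (2 * w ^+ 2 + g) * c + g * w.
  by transitivity (2 * w * c ^+ 2 + g * c - 2 * w ^+ 2 * c - g * w);
    [ring | rewrite cc; ring].
lra.
Qed.

Lemma pnorm_scale (R : realType) (p k x y : R) : 0 < p -> 0 <= k ->
  0 <= x -> 0 <= y -> pnorm p (k * x) (k * y) = k * pnorm p x y.
Proof.
move=> p0 k0 x0 y0; rewrite /pnorm !powRM // -mulrDr.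
by rewrite powRM ?addr_ge0 ?powR_ge0 // -powRrM mulfV ?gt_eqF // powRr1.
Qed.

Lemma wt_scale (R : realType) (p : R) k a b : 0 < p ->
  wt p (k * a) (k * b) = k%:R * wt p a b.
Proof. by move=> p0; rewrite /wt !natrM; apply: pnorm_scale. Qed.

Lemma rho_B3_lt_B2_six (R : realType) (p : R) : 2 <= p ->
  rho (psombor_mx p (B3 6)) < rho (psombor_mx p (B2 6)).
Proof.
move=> p2; have p1 : 1 <= p by lra.
have p0 : 0 < p by lra.
have W2 a b N : (0 < a)%N -> (a ^ 2 + b ^ 2 <= N)%N -> wt p a b ^+ 2 <= N%:R.
  move=> a0 h; apply: le_trans (wt_sqr_le b p2 a0) _.
  by rewrite -!natrX -natrD ler_nat.
have L2 a b N : (0 < a)%N -> (N <= a ^ 2)%N -> N%:R <= wt p a b ^+ 2.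
  move=> a0 h; apply: (@le_trans _ _ (a%:R ^+ 2)); first by rewrite -natrX ler_nat.
  by rewrite ler_sqr ?nnegrE ?ler0n ?wt_ge_max // ltW // wt_gt0.
have [c [c0 wc h1 h2 h3]] := six_witness (wt_ge_max 2 2 p1) (W2 2 2 8 isT isT)
  (L2 4 2 16 isT isT) (W2 4 2 20 isT isT) (L2 4 1 16 isT isT) (W2 4 1 17 isT isT)
  (W2 5 1 26 isT isT) (wt_six_coefficient p2).
apply: (@le_lt_trans _ _ c); last exact: (@rho_B2_gt R p 1 c p1 wc h3).
apply: (@rho_B3_le R p 1 c 1 p1 c0 ltr01); rewrite (wt_scale 2 2 2 p0).
  exact: h1.
exact: h2.
Qed.

(** * The three largest radii *)

(** Relations are coded as finite functions, so that a maximum over them exists; a graph of maximal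
    radius cannot be improved. *)
Lemma rho_max_nonuniv (R : realType) n (p : R) (e : rel 'I_n) :
  bicyclic e -> nonuniv e -> exists m : rel 'I_n,
  [/\ bicyclic m, nonuniv m, ~ improvable p m &
      rho (psombor_mx p e) <= rho (psombor_mx p m)].
Proof.
move=> be nu.
pose rel_of (f : {ffun 'I_n * 'I_n -> bool}) : rel 'I_n := fun x y => f (x, y).
pose code (r : rel 'I_n) := [ffun xy : 'I_n * 'I_n => r xy.1 xy.2].
have codeK r : rel_of (code r) = r.
  by apply: funext => x; apply: funext => y; rewrite /rel_of ffunE.
pose P f := `[< bicyclic (rel_of f) /\ nonuniv (rel_of f) >].
pose F f := rho (psombor_mx p (rel_of f)).
have P0 : P (code e) by apply/asboolP; rewrite codeK.
have [m [/asboolP [bm num] mmax]] : exists m, P m /\ forall f, P f -> F f <= F m.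
  by exists [arg max_(f > code e | P f) F f]%O; case: arg_maxP => // m Pm h; split.
exists (rel_of m); split => //.
- move=> [e' [be' nu' lt]].
  have : F (code e') <= F m by apply: mmax; apply/asboolP; rewrite codeK.
  by rewrite /F codeK leNgt lt.
- by have := mmax _ P0; rewrite /F codeK.
Qed.

Lemma rho_le_B3 (R : realType) n (p : R) (e : rel 'I_n.+4.+1) :
  1 <= p -> (0 < n)%N -> bicyclic e -> nonuniv e ->
  rho (psombor_mx p e) <= rho (psombor_mx p (B3 n.+4.+1)).
Proof.
move=> p1 n0 be nu; have [m [bm num nim le]] := rho_max_nonuniv p be nu.
apply: (le_trans le); have n6 : (6 <= n.+4.+1)%N by [].
have [iso|iso] := classify p1 n6 bm num nim.
  exact: (eq_ind_r (fun r => r <= _) (lexx _) (rho_iso p iso)).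
exact: (eq_ind_r (fun r => r <= _) (ltW (rho_kite_lt_B3 p1 n0)) (rho_iso p iso)).
Qed.

Theorem theorem5p3 (R : realType) (n : nat) (p : R)
  (hn : (6 <= n)%N) (hp : 2 <= p) (G : rel 'I_n)
  (hG : bicyclic G)
  (h1 : ~ graph_iso G (B1 n)) (h2 : ~ graph_iso G (B2 n)) (h3 : ~ graph_iso G (B3 n)) :
  [/\ rho (psombor_mx p G) < rho (psombor_mx p (B3 n)),
      rho (psombor_mx p (B3 n)) < rho (psombor_mx p (B2 n)) &
      rho (psombor_mx p (B2 n)) < rho (psombor_mx p (B1 n))].
Proof.
have p1 : 1 <= p by lra.
move: hn G hG h1 h2 h3; case: n => [|[|[|[|[|[|n]]]]]] // n6 G bG nB1 nB2 nB3.
split.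
- have nu : nonuniv G.
    apply: contrapT => nnu.
    have [u univ] : exists u, forall x, x != u -> G u x.
      apply: contrapT => no; apply: nnu => x; apply: contrapT => noy.
      apply: no; exists x => y yx; apply/negPn/negP => Gxy; apply: noy.
      by exists y.
    by have [] := universal_iso bG univ.
  (* [rho_le_B3] is only a weak bound. Strictness comes from one improving step, or, if there is
     none, from the kite being the only graph left besides B3. *)
  have [[e' [be' nu' lt]]|nim] := pselect (improvable p G).
    exact: lt_le_trans lt (rho_le_B3 p1 (ltn0Sn n) be' nu').
  have [//|iso] := classify p1 n6 bG nu nim.
  exact: (eq_ind_r (fun r => r < _) (rho_kite_lt_B3 p1 (ltn0Sn n)) (rho_iso p iso)).
- case: n {n6 G bG nB1 nB2 nB3} => [|n]; first exact: rho_B3_lt_B2_six.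
  exact: rho_B3_lt_B2_large.
- exact: rho_B2_lt_B1.
Qed.
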